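(* Let $U,V\in L^\infty(\mathbb{R})$ be real-valued functions of compact support and let $\{\alpha_\lambda\}_{\lambda>0}$ be positive numbers with $\alpha_\lambda\to+\infty$ as $\lambda\to0$. Let $H_\lambda=-\frac{d^2}{dx^2}+U(x)+\lambda\alpha_\lambda V(\alpha_\lambda x)$ on $W_2^2(\mathbb{R})$ and $H_0=-\frac{d^2}{dx^2}+U$. Suppose $H_0$ has a zero-energy resonance with normalized half-bound state $u$, and let $\theta=\lim_{x\to+\infty}u(x)$. If $$\int_{\mathbb{R}}V\,dx=0,\qquad u(0)u'(0)\int_{\mathbb{R}}xV(x)\,dx<0,$$ and $\alpha_\lambda=o(\lambda^{-1/3})$ as $\lambda\to0$, then $H_\lambda$ has the coupling constant threshold $\lambda=0$, and the threshold eigenvalue satisfies $$e_\lambda=-\frac{\lambda^2}{\alpha_\lambda^2}\left(\Big(\frac{2u(0)u'(0)}{\theta^2+1}\int_{\mathbb{R}}xV(x)\,dx\Big)^2+o(1)\right)\quad\text{as }\lambda\to0.$$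
   Context: $H_0$ possesses a zero-energy resonance if there is a nontrivial solution $h$ of $-h''+Uh=0$ bounded on $\mathbb{R}$ (a half-bound state); its limits $h_\pm=\lim_{x\to\pm\infty}h(x)$ exist and are nonzero, and the normalized half-bound state is $u=h/h_-$ (so $u\to1$ as $x\to-\infty$). The coupling constant threshold $\lambda=0$ means: for all small $\lambda>0$, $H_\lambda$ has a negative eigenvalue $e_\lambda$ with $e_\lambda\to0$ as $\lambda\to0$. *)

(* Defs.v *)
From HB Require Import structures.
From mathcomp Require Import all_boot all_order all_algebra.
From mathcomp Require Import all_classical all_reals all_analysis.
Set Implicit Arguments. Unset Strict Implicit. Unset Printing Implicit Defensive.
Import Order.TTheory GRing.Theory Num.Theory numFieldNormedType.Exports.
Local Open Scope classical_set_scope.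
Local Open Scope ring_scope.

(* U is (a representative of) a real L^oo function of compact support. *)
Definition Linfty_compact {R : realType} (U : R -> R) : Prop :=
  measurable_fun setT U /\
  (exists M : R, forall x, `|U x| <= M) /\
  (exists r : R, forall x, r < `|x| -> U x = 0).

Definition L2 {R : realType} (f : R -> R) : Prop :=
  (@lebesgue_measure R).-integrable setT (fun x => ((f x) ^+ 2)%:E).

Definition AC_with_deriv {R : realType} (g g2 : R -> R) : Prop :=
  forall a b : R, a <= b ->
    (@lebesgue_measure R).-integrable `[a, b] (fun x => (g2 x)%:E) /\
    g b - g a = Rintegral (@lebesgue_measure R) `[a, b] g2.

(* y belongs to the Sobolev space W_2^2(R): y is C^1, y' is absolutely
   continuous with a.e. derivative y2, and y, y', y2 are in L^2.
   The eigenvalue equation - y'' + W y = e y holds a.e.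
   e is an eigenvalue of H = -d^2/dx^2 + W on W_2^2(R). *)
Definition is_eigenvalue {R : realType} (W : R -> R) (e : R) : Prop :=
  exists (y y2 : R -> R),
    (exists x, y x != 0) /\
    (forall x, derivable y x 1) /\
    AC_with_deriv (derive1 y) y2 /\
    L2 y /\ L2 (derive1 y) /\ L2 y2 /\
    {ae (@lebesgue_measure R), forall x, - y2 x + W x * y x = e * y x}.

Definition half_bound_state {R : realType} (U h : R -> R) : Prop :=
  (exists x, h x != 0) /\
  (exists M : R, forall x, `|h x| <= M) /\
  (forall x, derivable h x 1) /\
  AC_with_deriv (derive1 h) (fun x => U x * h x).

(* Main.v *)
Require Import Defs.
From HB Require Import structures.
From mathcomp Require Import all_boot all_order all_algebra.
From mathcomp Require Import all_classical all_reals all_analysis.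
From mathcomp Require Import measurable_realfun ring lra.
Import Order.TTheory GRing.Theory Num.Theory numFieldNormedType.Exports.
Local Open Scope classical_set_scope.
Local Open Scope ring_scope.

(* Put W = U + l alpha V(alpha .) and look for an eigenvalue - w^2 with w > 0.
   The solution equal to hm e^{w x} on the left of the supports is e^{w x} v(x),
   where v and p = e^{2 w x} v' solve a linear Volterra system on a window
   [- rho, rho] containing the supports; it decays on the right exactly when
   p(rho) + 2 w e^{2 w rho} v(rho) = 0.  Since l alpha -> 0, W tends to U
   uniformly, so v and p are uniformly close to h and h'.  The Wronskian of the
   solution with h then gives, V having zero mean,
     hp (p(rho) + 2 w e^{2 w rho} v(rho)) =
       w (hp^2 + hm^2) + (l / alpha) 2 h(0) h'(0) \int x V
       + o(w + l / alpha),
   and the intermediate value theorem provides a root w ~ c l / alpha with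
   c = - 2 h(0) h'(0) \int x V / (hp^2 + hm^2). *)

(** * Measurable, locally bounded functions and their integrals over compact intervals *)

Section locally_bounded.
Set Implicit Arguments. Unset Strict Implicit. Unset Printing Implicit Defensive.
Context {R : realType}.
Implicit Types f g : R -> R.
Local Notation mu := (@lebesgue_measure R).

(** The factor [expR (2 * w * x)] in [p] absorbs the first-order term [2 * w * v'], so that [h] and
    [h'] solve the same system with [w = 0] and [W = U], with the same data at [- rho]. The
    comparison then only concerns coefficients, and all constants are uniform in [l], [al] and [w].

    The delicate term is the one with [V], of size [l / al]. Since [V] has zero mean, only the
    increments of the solution over an interval of length of order [al^-1] count. They are
    controlled by the closeness of [p] to [h'], so the error keeps the full factor [l / al]. This is
    why [v] and [p] are estimated together.

    As [U] and [V] are merely bounded and measurable, second derivatives exist only in integrated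
    form. Equations are therefore integral equations between functions satisfying [lbm], a class
    stable under sums and products, containing coefficients and solutions alike, and integrable on
    every compact interval. *)

Definition lbm f := measurable_fun setT f /\
  forall b : R, exists M : R, forall x, `|x| <= b -> `|f x| <= M.

Lemma lbm_cst (c : R) : lbm (fun=> c).
Proof. by split=> // b; exists `|c|. Qed.

Lemma lbmD f g : lbm f -> lbm g -> lbm (fun x => f x + g x).
Proof.
move=> [mf bf] [mg bg]; split; first exact: measurable_funD.
move=> b; have [M Mf] := bf b; have [N Ng] := bg b; exists (M + N) => x xb.
by rewrite (le_trans (ler_normD _ _))// lerD ?Mf ?Ng.
Qed.

Lemma lbmM f g : lbm f -> lbm g -> lbm (fun x => f x * g x).
Proof.
move=> [mf bf] [mg bg]; split; first exact: measurable_funM.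
move=> b; have [M Mf] := bf b; have [N Ng] := bg b; exists (M * N) => x xb.
by rewrite normrM ler_pM ?Mf ?Ng.
Qed.

Lemma lbmZ (c : R) f : lbm f -> lbm (fun x => c * f x).
Proof. by apply: lbmM; exact: lbm_cst. Qed.

Lemma lbmB f g : lbm f -> lbm g -> lbm (fun x => f x - g x).
Proof.
move=> lf lg; have := lbmD lf (lbmZ (-1) lg).
by congr lbm; apply/funext => x; rewrite mulN1r.
Qed.

Lemma lbm_continuous f : continuous f -> lbm f.
Proof.
move=> cf; split; first exact: continuous_measurable_fun.
move=> b; have [b0|b0] := leP 0 b; last first.
  by exists 0 => x xb; have := normr_ge0 x; lra.
have [||c _ cm] := @EVT_max R (fun x => `|f x|) (- b) b.
- lra.
- apply: continuous_subspaceT => x.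
  exact: (@continuous_comp _ _ _ f (fun z => `|z|) _ (cf x) (@norm_continuous _ _ _)).
- by exists `|f c| => x xb; apply: cm; rewrite in_itv/= -ler_norml.
Qed.

Lemma lbm_Linfty f : Linfty_compact f -> lbm f.
Proof. by move=> [mf [[M fM] _]]; split=> // b; exists M => x _. Qed.

Lemma lbm_id : lbm (@idfun R).
Proof. by apply: lbm_continuous => x; exact: cvg_id. Qed.

Lemma lbm_integrable a b f : lbm f -> mu.-integrable `[a, b] (EFin \o f).
Proof.
move=> [mf bf]; apply: measurable_bounded_integrable => //.
- by rewrite /= lebesgue_measure_itv/=; case: ifP => _; rewrite -?EFinB ltry.
- exact: measurable_funTS.
- have [M fM] := bf (`|a| + `|b|).
  exists M; split; first exact: num_real.
  move=> N MN x /=; rewrite in_itv/= => /andP[ax xb].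
  apply: (le_trans (fM _ _) (ltW MN)).
  rewrite ler_norml; apply/andP; split.
    have := ler_norm (- a); have := normr_ge0 b; rewrite normrN; lra.
  have := ler_norm b; have := normr_ge0 a; lra.
Qed.

Lemma int_cat a b c f : lbm f -> a <= b -> b <= c ->
  \int[mu]_(x in `[a, c]) f x =
  \int[mu]_(x in `[a, b]) f x + \int[mu]_(x in `[b, c]) f x.
Proof.
move=> lf ab bc; have := @Rintegral_itvB _ f (BLeft a) (BRight c) b.
rewrite !bnd_simp => /(_ (lbm_integrable a c lf) ab bc).
rewrite Rintegral_itv_obnd_cbnd; first by move=> <-; ring.
by apply: integrableS (lbm_integrable b c lf) => //; exact: subset_itv_oc_cc.
Qed.

Lemma int_point a f : \int[mu]_(x in `[a, a]) f x = 0.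
Proof. by rewrite set_itv1 Rintegral_set1. Qed.

Lemma intD a b f g : lbm f -> lbm g ->
  \int[mu]_(x in `[a, b]) (f x + g x) =
  \int[mu]_(x in `[a, b]) f x + \int[mu]_(x in `[a, b]) g x.
Proof. by move=> lf lg; rewrite RintegralD//; exact: lbm_integrable. Qed.

Lemma intB a b f g : lbm f -> lbm g ->
  \int[mu]_(x in `[a, b]) (f x - g x) =
  \int[mu]_(x in `[a, b]) f x - \int[mu]_(x in `[a, b]) g x.
Proof. by move=> lf lg; rewrite RintegralB//; exact: lbm_integrable. Qed.

Lemma intZ a b c f : lbm f ->
  \int[mu]_(x in `[a, b]) (c * f x) = c * \int[mu]_(x in `[a, b]) f x.
Proof. by move=> lf; rewrite RintegralZl//; exact: lbm_integrable. Qed.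

Lemma int_cst (a b c : R) : a <= b -> \int[mu]_(x in `[a, b]) c = c * (b - a).
Proof.
move=> ab; rewrite Rintegral_cst//= lebesgue_measure_itv/= lte_fin.
by case: ltP => // ba; congr (_ * _) => /=; lra.
Qed.

Lemma eq_int a b f g : (forall x, a <= x <= b -> f x = g x) ->
  \int[mu]_(x in `[a, b]) f x = \int[mu]_(x in `[a, b]) g x.
Proof.
move=> fg; apply: eq_Rintegral => x; rewrite inE/= in_itv/=; exact: fg.
Qed.

Lemma le_int_norm a b f g : lbm f -> lbm g ->
  (forall x, a <= x <= b -> `|f x| <= g x) ->
  `|\int[mu]_(x in `[a, b]) f x| <= \int[mu]_(x in `[a, b]) g x.
Proof.
move=> lf lg fg; have inf := lbm_integrable a b lf.
rewrite (le_trans (le_normr_Rintegral _ inf))//.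
apply: le_Rintegral => //.
- apply: lbm_integrable; case: lf => mf bf; split; last first.
    by move=> c; have [M fM] := bf c; exists M => x /fM; rewrite normr_id.
  exact: measurableT_comp.
- exact: lbm_integrable.
Qed.

Lemma le_int_bound a b f (M : R) : lbm f -> a <= b ->
  (forall x, a <= x <= b -> `|f x| <= M) ->
  `|\int[mu]_(x in `[a, b]) f x| <= M * (b - a).
Proof.
by move=> lf ab fM; rewrite -int_cst//; apply: le_int_norm => //; exact: lbm_cst.
Qed.

End locally_bounded.

(** * Calculus of absolutely continuous functions with locally bounded derivative *)

Section absolutely_continuous.
Set Implicit Arguments. Unset Strict Implicit. Unset Printing Implicit Defensive.
Context {R : realType}.
Implicit Types f g F G : R -> R.
Local Notation mu := (@lebesgue_measure R).

Lemma AC_intro F f : lbm f ->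
  (forall a b, a <= b -> F b - F a = \int[mu]_(x in `[a, b]) f x) ->
  AC_with_deriv F f.
Proof. by move=> lf h a b ab; split; [exact: lbm_integrable|exact: h]. Qed.

Lemma AC_int F f a b : AC_with_deriv F f -> a <= b ->
  F b = F a + \int[mu]_(x in `[a, b]) f x.
Proof. by move=> h ab; rewrite -(h a b ab).2; ring. Qed.

Lemma AC_ext F f g : (forall x, f x = g x) ->
  AC_with_deriv F f -> AC_with_deriv F g.
Proof. by move=> /funext ->. Qed.

Lemma ACD F G f g : lbm f -> lbm g ->
  AC_with_deriv F f -> AC_with_deriv G g ->
  AC_with_deriv (fun x => F x + G x) (fun x => f x + g x).
Proof.
move=> lf lg hF hG; apply: AC_intro; first exact: lbmD.
by move=> a b ab; rewrite intD// -(hF a b ab).2 -(hG a b ab).2; ring.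
Qed.

Lemma ACZ c F f : lbm f ->
  AC_with_deriv F f -> AC_with_deriv (fun x => c * F x) (fun x => c * f x).
Proof.
move=> lf hF; apply: AC_intro; first exact: lbmZ.
by move=> a b ab; rewrite intZ// -(hF a b ab).2; ring.
Qed.

Lemma AC_cst (c : R) : AC_with_deriv (fun=> c) (fun=> 0).
Proof.
apply: AC_intro; first exact: lbm_cst.
by move=> a b ab; rewrite int_cst// subrr mul0r.
Qed.

(** One of the two intervals is empty unless [x = a], where both integrals are zero: this is the
    oriented integral from [a] to [x]. *)
Definition prim (a : R) f (x : R) :=
  \int[mu]_(t in `[a, x]) f t - \int[mu]_(t in `[x, a]) f t.

Lemma prim_ge a f x : a <= x -> prim a f x = \int[mu]_(t in `[a, x]) f t.
Proof.
rewrite /prim le_eqVlt => /predU1P[->|ax]; first by rewrite int_point subr0.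
by rewrite [X in _ - X](_ : _ = 0) ?subr0// set_itv_ge ?Rintegral_set0// bnd_simp -ltNge.
Qed.

Lemma prim_le a f x : x <= a -> prim a f x = - \int[mu]_(t in `[x, a]) f t.
Proof.
rewrite /prim le_eqVlt => /predU1P[->|ax]; first by rewrite int_point add0r.
by rewrite [X in X - _](_ : _ = 0) ?add0r// set_itv_ge ?Rintegral_set0// bnd_simp -ltNge.
Qed.

Lemma AC_prim a f : lbm f -> AC_with_deriv (prim a f) f.
Proof.
move=> lf; apply: AC_intro => // b c bc.
have [ab|/ltW ba] := leP a b.
  by rewrite !prim_ge//; [rewrite (int_cat lf ab bc); ring|exact: le_trans bc].
have [ac|/ltW ca] := leP a c.
  by rewrite (prim_le _ ba) (prim_ge _ ac) (int_cat lf ba ac); ring.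
by rewrite !prim_le// (int_cat lf bc ca); ring.
Qed.

Lemma AC_lip F f a b (M : R) : lbm f -> AC_with_deriv F f ->
  (forall x, a <= x <= b -> `|f x| <= M) ->
  forall x y, a <= x <= b -> a <= y <= b -> `|F y - F x| <= M * `|y - x|.
Proof.
move=> lf hF fM x y; wlog xy : x y / x <= y => [hw hx hy|/andP[ax xb] /andP[ay yb]].
  by have [xy|/ltW yx] := leP x y; [exact: hw|rewrite distrC (distrC y); exact: hw].
rewrite (hF _ _ xy).2 [X in _ <= _ * X]ger0_norm ?subr_ge0//.
apply: le_int_bound => // z /andP[xz zy]; apply: fM.
by rewrite (le_trans ax xz) (le_trans zy yb).
Qed.

Lemma AC_continuous F f : lbm f -> AC_with_deriv F f -> continuous F.
Proof.
move=> lf hF x; have [M fM] := lf.2 (`|x| + 1).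
have M0 : 0 <= M.
  by apply: le_trans (fM x _); rewrite ?normr_ge0// lerDl.
apply/cvgrPdist_le => e e0.
near=> t.
have tx : `|x - t| <= 1 by near: t; apply: cvgr_dist_le => //; exact: ltr01.
have tx2 : `|x - t| <= e / (M + 1).
  by near: t; apply: cvgr_dist_le => //; apply: divr_gt0 => //; lra.
rewrite (le_trans (AC_lip (a := x - 1) (b := x + 1) (M := M) lf hF _ _ _))//.
- move=> z zx; apply: fM; have : `|z - x| <= 1 by rewrite ler_norml; lra.
  have := ler_normD (z - x) x; rewrite subrK; lra.
- by move: tx; rewrite ler_norml; lra.
- lra.
- move: tx2; rewrite ler_pdivlMr ?ltr_wpDl//.
  have := normr_ge0 (x - t); lra.
Unshelve. all: by end_near. Qed.

Lemma AC_lbm F f : lbm f -> AC_with_deriv F f -> lbm F.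
Proof. by move=> lf hF; exact/lbm_continuous/(AC_continuous lf hF). Qed.

Lemma is_derive_of_estimate F (x l : R) :
  (forall e, 0 < e -> exists2 d, 0 < d &
    forall t, `|t| < d -> `|F (t + x) - F x - t * l| <= e * `|t|) ->
  is_derive x 1 F l.
Proof.
move=> h.
have hl : t^-1 *: (F (t *: (1 : R) + x) - F x) @[t --> 0^'] --> l.
  apply/cvgrPdist_le => e e0; have [d d0 hd] := h e e0.
  near=> t.
  have t0 : t != 0 by near: t; exact: nbhs_dnbhs_neq.
  have td : `|t| < d.
    near: t; apply: dnbhs0_lt => //.
  have := hd t td; rewrite -[t *: 1]/(t * 1) mulr1 -[_ *: _]/(_ * _) => ht.
  rewrite distrC -(@ler_pM2r _ `|t|) ?normr_gt0// -normrM mulrBl.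
  rewrite -mulrA [X in _ * X - _]mulrC mulrA mulVf// mul1r [l * _]mulrC.
  exact: ht.
apply: DeriveDef; first by apply: cvgP hl.
exact: (cvg_lim _ hl).
Unshelve. all: by end_near. Qed.

(** The quadratic bound makes the derivative vanish at every point. This serves to identify two
    primitives that need not be differentiable everywhere. *)
Lemma cst_of_quadratic F :
  (forall b, exists C, forall x y, `|x| <= b -> `|y| <= b ->
     `|F y - F x| <= C * (y - x) ^+ 2) -> forall x y, F x = F y.
Proof.
move=> h x y; apply: is_derive_0_is_cst => z; apply: is_derive_of_estimate => e e0.
have [C hC] := h (`|z| + 1).
exists (Num.min 1 (e / (`|C| + 1))).
  by rewrite lt_min ltr01/= divr_gt0// ltr_wpDl.
move=> t; rewrite lt_min => /andP[t1 te]; rewrite mulr0 subr0.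
have tz : `|t + z| <= `|z| + 1.
  by rewrite (le_trans (ler_normD _ _))// addrC lerD2l ltW.
rewrite (le_trans (hC z (t + z) _ tz)) ?lerDl// addrK.
rewrite -real_normK ?num_real// expr2 mulrA; apply: ler_wpM2r => //.
rewrite (@le_trans _ _ ((`|C| + 1) * `|t|))//.
  by apply: ler_wpM2r => //; rewrite (le_trans (ler_norm _))// lerDl.
by rewrite mulrC -ler_pdivlMr ?ltW// ltr_wpDl.
Qed.

(** Subtracting [z * f x] leaves a function whose density is at most [e] near [x], hence
    [e]-Lipschitz there. *)
Lemma AC_derive F f x : lbm f -> AC_with_deriv F f ->
  {for x, continuous f} -> is_derive x 1 F (f x).
Proof.
move=> lf hF cf; apply: is_derive_of_estimate => e e0.
move/cvgrPdist_le : cf => /(_ e e0); rewrite near_simpl => /nbhs_ballP[d /= d0 hd].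
exists d => // t td.
pose a := Num.min x (t + x); pose b := Num.max x (t + x).
have lg : lbm (fun z => f z - f x) by apply: lbmB => //; exact: lbm_cst.
have hG : AC_with_deriv (fun z => F z - z * f x) (fun z => f z - f x).
  apply: AC_intro => // u v uv.
  by rewrite intB ?int_cst//; [rewrite -(hF _ _ uv).2; ring|exact: lbm_cst].
have := AC_lip (a := a) (b := b) (M := e) lg hG.
move=> /(_ _ x (t + x)); rewrite addrK.
have -> : F (t + x) - (t + x) * f x - (F x - x * f x) = F (t + x) - F x - t * f x.
  by ring.
apply.
- move=> z zab; rewrite distrC; apply: hd; rewrite /ball/=.
  apply: le_lt_trans td.
  have := ler_norm t; have := ler_norm (- t); rewrite normrN.
  move: zab; rewrite /a /b /Num.min /Num.max ler_norml; case: ltP => h; lra.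
- by rewrite /a /b ge_min lexx le_max lexx.
- by rewrite /a /b ge_min lexx le_max lexx !orbT.
Qed.

Lemma derive_AC F f :
  continuous f -> (forall x : R, is_derive x 1 F (f x)) ->
  AC_with_deriv F f.
Proof.
move=> cf dF; have lf := lbm_continuous cf.
apply: AC_intro => // a b ab.
have hP := AC_prim a lf.
have : F b - prim a f b = F a - prim a f a.
  apply: (@is_derive_0_is_cst _ (fun x => F x - prim a f x)) => x.
  have dP := AC_derive lf hP (cf x).
  by apply: is_derive_eq; rewrite subrr.
by rewrite !prim_ge// int_point; lra.
Qed.

(** Over [[x, y]], the increment of [F * G] minus that of the candidate primitive is the integral of
    [f t * (G x - G t) + g t * (F y - F t)]. It is quadratic in [y - x], since [F] and [G] are
    locally Lipschitz, so [cst_of_quadratic] applies. *)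
Lemma ACM F G f g : lbm f -> lbm g ->
  AC_with_deriv F f -> AC_with_deriv G g ->
  AC_with_deriv (fun x => F x * G x) (fun x => f x * G x + F x * g x).
Proof.
move=> lf lg hF hG.
have lF := AC_lbm lf hF; have lG := AC_lbm lg hG.
have lk : lbm (fun x => f x * G x + F x * g x) by apply: lbmD; exact: lbmM.
apply: AC_intro => // a b ab.
have hP := AC_prim a lk.
have : F b * G b - prim a (fun x => f x * G x + F x * g x) b =
       F a * G a - prim a (fun x => f x * G x + F x * g x) a.
  apply: (@cst_of_quadratic
    (fun x => F x * G x - prim a (fun x => f x * G x + F x * g x) x)) => c.
  have [A fA] := lf.2 c; have [B gB] := lg.2 c.
  exists (2 * (A * B)) => x y.
  wlog xy : x y / x <= y => [hw hx hy|hx hy].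
    have [xy|/ltW yx] := leP x y; first exact: hw.
    by rewrite distrC -sqrrN (opprB y); exact: hw.
  have cc z : x <= z <= y -> `|z| <= c.
    by move: hx hy; rewrite !ler_norml; lra.
  have A0 : 0 <= A by apply: le_trans (fA x hx).
  have B0 : 0 <= B by apply: le_trans (gB x hx).
  rewrite (AC_int hP xy).
  have -> : F y * G y - (prim a (fun x => f x * G x + F x * g x) x +
      \int[mu]_(t in `[x, y]) (f t * G t + F t * g t)) -
      (F x * G x - prim a (fun x => f x * G x + F x * g x) x) =
      \int[mu]_(t in `[x, y]) (f t * (G x - G t) + g t * (F y - F t)).
    have -> : F y * G y = F x * G x + (F y - F x) * G x + F y * (G y - G x) by ring.
    rewrite (hF _ _ xy).2 (hG _ _ xy).2.
    have l1 : lbm (fun t => f t * G x) by apply: lbmM => //; exact: lbm_cst.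
    have l2 : lbm (fun t => F y * g t) by exact: lbmZ.
    have -> : \int[mu]_(t in `[x, y]) (f t * (G x - G t) + g t * (F y - F t)) =
      \int[mu]_(t in `[x, y]) ((f t * G x + F y * g t) - (f t * G t + F t * g t)).
      by apply: eq_int => t _; ring.
    rewrite intB//; last exact: lbmD.
    rewrite [X in _ = X - _](intD x y l1 l2) (intZ x y (F y) lg).
    have -> : \int[mu]_(t in `[x, y]) (f t * G x) = \int[mu]_(t in `[x, y]) f t * G x.
      by rewrite mulrC -intZ//; apply: eq_int => t _; ring.
    by ring.
  have l3 : lbm (fun t => f t * (G x - G t) + g t * (F y - F t)).
    apply: lbmD; apply: lbmM => //; apply: lbmB => //; exact: lbm_cst.
  have -> : 2 * (A * B) * (y - x) ^+ 2 = (2 * (A * B) * (y - x)) * (y - x) by ring.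
  apply: le_int_bound => // t xty.
  have xt0 : x <= x <= y by rewrite lexx.
  have yt0 : x <= y <= y by rewrite lexx andbT.
  have h1 : `|G x - G t| <= B * `|x - t|.
    by apply: (AC_lip (a := x) (b := y) lg hG) => // z /cc /gB.
  have h2 : `|F y - F t| <= A * `|y - t|.
    by apply: (AC_lip (a := x) (b := y) lf hF) => // z /cc /fA.
  have h3 : `|x - t| <= y - x by rewrite ler_norml; lra.
  have h4 : `|y - t| <= y - x by rewrite ler_norml; lra.
  rewrite (le_trans (ler_normD _ _))// !normrM.
  have h5 : `|f t| * `|G x - G t| <= A * (B * (y - x)).
    by apply: ler_pM => //; [exact/fA/cc|exact: le_trans h1 (ler_wpM2l _ _)].
  have h6 : `|g t| * `|F y - F t| <= B * (A * (y - x)).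
    by apply: ler_pM => //; [exact/gB/cc|exact: le_trans h2 (ler_wpM2l _ _)].
  lra.
rewrite !prim_ge// int_point; lra.
Qed.

End absolutely_continuous.

(** * Exponential weights and geometric convergence *)

Section exponential_weights.
Set Implicit Arguments. Unset Strict Implicit. Unset Printing Implicit Defensive.
Context {R : realType}.
Implicit Types f g : R -> R.
Local Notation mu := (@lebesgue_measure R).

Lemma continuous_expZ (k : R) : continuous (fun s => expR (k * s)).
Proof.
by move=> x; apply: continuous_comp; [exact: mulrl_continuous|exact: continuous_expR].
Qed.

Lemma lbm_expZ (k : R) : lbm (fun s => expR (k * s)).
Proof. exact/lbm_continuous/continuous_expZ. Qed.

Lemma AC_expZ (k : R) :
  AC_with_deriv (fun s => expR (k * s)) (fun s => k * expR (k * s)).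
Proof.
apply: derive_AC.
  move=> x; apply: cvgM; [exact: cvg_cst|exact: continuous_expZ].
move=> x.
have h1 : is_derive x 1 (fun s => k * s) k.
  by apply: is_derive_eq; rewrite -[_ *: _]/(_ * _) mulr1.
by rewrite mulrC; exact: (@is_derive1_comp _ expR (fun s => k * s)).
Qed.

Lemma le_geo_cvg0 (C u v : R) : (forall n, u <= C / 2 ^+ n + v) -> u <= v.
Proof.
move=> h; rewrite -[v]add0r.
apply: (@ler_cvg_to _ \oo _ _ (fun=> u) (fun n => geometric C 2^-1 n + v)).
- exact: cvg_cst.
- apply: cvgD; last exact: cvg_cst.
  by apply: cvg_geometric; rewrite ger0_norm ?invr_ge0// invf_lt1// ltr1n.
- by near=> n; rewrite /geometric/= exprVn; exact: h.
Unshelve. all: by end_near. Qed.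

(** The sequences [u n + 2 * C / 2 ^+ n] and [u n - 2 * C / 2 ^+ n] are respectively decreasing and
    increasing, so they enclose a limit, with an explicit rate. *)
Lemma geo_increments_lim (u : R ^nat) (C : R) :
  (forall n, `|u n.+1 - u n| <= C / 2 ^+ n) ->
  exists l, forall n, `|l - u n| <= 2 * C / 2 ^+ n.
Proof.
move=> h.
have half n : C / 2 ^+ n = 2 * (C / 2 ^+ n.+1).
  by rewrite exprS; field; rewrite expf_neq0.
pose A n := u n + 2 * C / 2 ^+ n; pose B n := u n - 2 * C / 2 ^+ n.
have Adec n : A n.+1 <= A n.
  have := h n; rewrite /A ler_norml -!mulrA half; lra.
have Binc n : B n <= B n.+1.
  have := h n; rewrite /B ler_norml -!mulrA half; lra.
have BA n : B n <= A n.
  rewrite /B /A; have := le_trans (normr_ge0 _) (h n); rewrite -!mulrA; lra.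
have Amon m n : (m <= n)%N -> A n <= A m.
  by move=> /subnK <-; elim: (n - m)%N => // k; apply: le_trans; rewrite addSn.
have Bmon m n : (m <= n)%N -> B m <= B n.
  move=> /subnK <-; elim: (n - m)%N => // k ih; apply: le_trans ih _.
  by rewrite addSn.
have BmA m n : B m <= A n.
  by apply: le_trans (Bmon _ _ (leq_maxl m n)) (le_trans (BA _) (Amon _ _ (leq_maxr m n))).
exists (inf (range A)) => n; rewrite ler_norml.
have h1 : inf (range A) <= A n.
  by apply: ge_inf; [exists (B 0%N) => _ [m _ <-]|exists n].
have h2 : B n <= inf (range A).
  by apply: lb_le_inf; [exists (A 0%N), 0%N|move=> _ [m _ <-]].
by move: h1 h2; rewrite /A /B; lra.
Qed.

(** Integrating the weight [expR (K * (x - a))] from [a] reproduces it with a factor [K^-1], up to a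
    nonpositive term. A large rate thus makes integration contracting on an interval of any
    length. *)
Lemma le_int_weight a b (K C : R) f : 0 < K -> 0 <= C -> lbm f ->
  (forall x, a <= x <= b -> `|f x| <= C * expR (K * (x - a))) ->
  forall x, a <= x <= b ->
    `|\int[mu]_(t in `[a, x]) f t| <= C / K * expR (K * (x - a)).
Proof.
move=> K0 C0 lf hf x /andP[ax xb].
pose c := C * expR (- (K * a)).
have eE t : C * expR (K * (t - a)) = c * expR (K * t).
  by rewrite mulrBr expRD /c; ring.
have lE : lbm (fun t => c * expR (K * t)) by apply: lbmZ; exact: lbm_expZ.
have hint : \int[mu]_(t in `[a, x]) (c * expR (K * t)) =
    c / K * (expR (K * x) - expR (K * a)).
  rewrite ((AC_expZ K) _ _ ax).2 (intZ _ _ _ (lbm_expZ K)).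
  rewrite (intZ _ _ _ (lbm_expZ K)); field; exact: lt0r_neq0.
apply: (@le_trans _ _ (\int[mu]_(t in `[a, x]) (c * expR (K * t)))).
  apply: le_int_norm => // t /andP[at_ tx]; rewrite -eE; apply: hf.
  by rewrite at_ (le_trans tx).
rewrite hint (_ : C / K * expR _ = c / K * expR (K * x)); last first.
  by rewrite mulrAC eE; ring.
apply: ler_wpM2l.
  by rewrite divr_ge0// ?mulr_ge0 ?expR_ge0// ltW.
by rewrite gerBl expR_ge0.
Qed.

End exponential_weights.

(** * Stability, perturbation and existence for a Volterra system of two equations *)

Section volterra_system.
Set Implicit Arguments. Unset Strict Implicit. Unset Printing Implicit Defensive.
Context {R : realType}.
Implicit Types f g d e : R -> R.
Local Notation mu := (@lebesgue_measure R).

(* The exponential weight of rate [2 G] makes the Volterra operator a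
   contraction of ratio 1/2. *)
Lemma volterra_contract a b (G D : R) f d : 0 < G -> 0 <= D ->
  lbm f -> lbm d ->
  (forall x, a <= x <= b -> `|f x| <= G) ->
  (forall x, a <= x <= b -> `|d x| <= D * expR (2 * G * (x - a))) ->
  forall x, a <= x <= b ->
    `|\int[mu]_(t in `[a, x]) (f t * d t)| <= D / 2 * expR (2 * G * (x - a)).
Proof.
move=> G0 D0 lf ld hf hd x xab.
have -> : D / 2 = (G * D) / (2 * G) by field; exact: lt0r_neq0.
apply: (le_int_weight (b := b)) => //.
- by rewrite mulr_gt0.
- by rewrite mulr_ge0// ltW.
- exact: lbmM.
- move=> t tab; rewrite normrM -mulrA; apply: ler_pM => //; [exact: hf|exact: hd].
Qed.

Lemma weight_ge1 (a x K : R) : 0 <= K -> a <= x -> 1 <= expR (K * (x - a)).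
Proof. by move=> K0 ax; rewrite -expR0 ler_expR mulr_ge0// subr_ge0. Qed.

(** By the contraction, a bound [D] on both unknowns, relative to the weight, improves to
    [D / 2 + eps]. Iterating from a crude bound on the window leads to the fixed point [2 * eps]. *)
Lemma volterra_stability a b (G eps : R) f g d e : 0 < G -> 0 <= eps ->
  lbm f -> lbm g -> lbm d -> lbm e ->
  (forall x, a <= x <= b -> `|f x| <= G) ->
  (forall x, a <= x <= b -> `|g x| <= G) ->
  (forall x, a <= x <= b ->
    `|d x - \int[mu]_(t in `[a, x]) (g t * e t)| <= eps * expR (2 * G * (x - a))) ->
  (forall x, a <= x <= b ->
    `|e x - \int[mu]_(t in `[a, x]) (f t * d t)| <= eps * expR (2 * G * (x - a))) ->
  forall x, a <= x <= b -> `|d x| <= 2 * eps * expR (2 * G * (x - a)) /\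
                           `|e x| <= 2 * eps * expR (2 * G * (x - a)).
Proof.
move=> G0 eps0 lf lg ld le hf hg hd he x xab.
have [M1 dM] := ld.2 (`|a| + `|b|); have [M2 eM] := le.2 (`|a| + `|b|).
pose C := `|M1| + `|M2|.
have C0 : 0 <= C by rewrite addr_ge0.
have inb z : a <= z <= b -> `|z| <= `|a| + `|b|.
  have := ler_norm (- a); have := ler_norm b; rewrite normrN.
  by have := normr_ge0 a; have := normr_ge0 b; rewrite ler_norml; lra.
suff main n : forall z, a <= z <= b ->
    `|d z| <= (C / 2 ^+ n + 2 * eps) * expR (2 * G * (z - a)) /\
    `|e z| <= (C / 2 ^+ n + 2 * eps) * expR (2 * G * (z - a)).
  have w0 : 0 < expR (2 * G * (x - a)) by exact: expR_gt0.
  split; rewrite -ler_pdivrMr//; apply: (@le_geo_cvg0 _ C) => n;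
    by rewrite ler_pdivrMr//; case: (main n x xab).
elim: n => [|n ih] z zab.
  rewrite expr0 divr1.
  have w1 : 1 <= expR (2 * G * (z - a)).
    by apply: weight_ge1; [rewrite mulr_ge0// ltW|case/andP: zab].
  have h1 := dM z (inb z zab); have h2 := eM z (inb z zab).
  have h3 := ler_norm M1; have h4 := ler_norm M2.
  have h5 := normr_ge0 M1; have h6 := normr_ge0 M2.
  have h7 : C + 2 * eps <= (C + 2 * eps) * expR (2 * G * (z - a)).
    by rewrite ler_peMr// addr_ge0// mulr_ge0.
  by split; apply: le_trans h7; rewrite /C; lra.
set D := C / 2 ^+ n + 2 * eps in ih.
have D0 : 0 <= D by rewrite addr_ge0 ?mulr_ge0// ?invr_ge0 ?exprn_ge0.
have -> : C / 2 ^+ n.+1 + 2 * eps = D / 2 + eps.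
  by rewrite /D exprS; field; rewrite expf_neq0.
have k1 := volterra_contract G0 D0 lg le hg (fun z zab => (ih z zab).2) zab.
have k2 := volterra_contract G0 D0 lf ld hf (fun z zab => (ih z zab).1) zab.
have := hd z zab; have := he z zab; set w := expR _ in k1 k2 *.
move=> m2 m1; split.
  rewrite -[d z](subrK (\int[mu]_(t in `[a, z]) (g t * e t))).
  by rewrite (le_trans (ler_normD _ _))// mulrDl addrC lerD.
rewrite -[e z](subrK (\int[mu]_(t in `[a, z]) (f t * d t))).
by rewrite (le_trans (ler_normD _ _))// mulrDl addrC lerD.
Qed.

(** The pair solves the homogeneous system up to the constant residual [A], which is dominated by
    the weight because the latter is at least 1. *)
Lemma volterra_bound a b (G : R) f g v p (A : R) : 0 < G ->
  lbm f -> lbm g -> lbm v -> lbm p ->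
  (forall x, a <= x <= b -> `|f x| <= G) ->
  (forall x, a <= x <= b -> `|g x| <= G) ->
  (forall x, a <= x <= b -> v x = A + \int[mu]_(t in `[a, x]) (g t * p t)) ->
  (forall x, a <= x <= b -> p x = \int[mu]_(t in `[a, x]) (f t * v t)) ->
  forall x, a <= x <= b -> `|v x| <= 2 * `|A| * expR (2 * G * (x - a)) /\
                           `|p x| <= 2 * `|A| * expR (2 * G * (x - a)).
Proof.
move=> G0 lf lg lv lp hf hg hv hp; apply: (volterra_stability (f := f) (g := g)) => // x xab.
  rewrite hv// addrK ler_peMr//; apply: weight_ge1; last by case/andP: xab.
  by rewrite mulr_ge0// ltW.
by rewrite hp// subrr normr0 mulr_ge0// expR_ge0.
Qed.

(** The differences solve the system with coefficients [f] and [g] up to the integrals of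
    [(f - f') * v'] and [(g - g') * p']. Bounding [v'] and [p'] by [volterra_bound] and integrating
    the weight of rate [2 * G] produces the quotient by [2 * G]; the outer factor 2 is that of
    [volterra_stability]. *)
Lemma volterra_perturbation a b (G delta : R) f g v p f' g' v' p' (A : R) :
  0 < G -> 0 <= delta ->
  lbm f -> lbm g -> lbm v -> lbm p -> lbm f' -> lbm g' -> lbm v' -> lbm p' ->
  (forall x, a <= x <= b -> `|f x| <= G /\ `|f' x| <= G /\ `|f x - f' x| <= delta) ->
  (forall x, a <= x <= b -> `|g x| <= G /\ `|g' x| <= G /\ `|g x - g' x| <= delta) ->
  (forall x, a <= x <= b -> v x = A + \int[mu]_(t in `[a, x]) (g t * p t)) ->
  (forall x, a <= x <= b -> p x = \int[mu]_(t in `[a, x]) (f t * v t)) ->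
  (forall x, a <= x <= b -> v' x = A + \int[mu]_(t in `[a, x]) (g' t * p' t)) ->
  (forall x, a <= x <= b -> p' x = \int[mu]_(t in `[a, x]) (f' t * v' t)) ->
  forall x, a <= x <= b ->
    `|v x - v' x| <= 2 * (delta * (2 * `|A|) / (2 * G)) * expR (2 * G * (x - a)) /\
    `|p x - p' x| <= 2 * (delta * (2 * `|A|) / (2 * G)) * expR (2 * G * (x - a)).
Proof.
move=> G0 dl0 lf lg lv lp lf' lg' lv' lp' hf hg hv hp hv' hp'.
have bd' := volterra_bound G0 lf' lg' lv' lp' (fun x xab => (hf x xab).2.1)
  (fun x xab => (hg x xab).2.1) hv' hp'.
have G20 : 0 < 2 * G by rewrite mulr_gt0.
have key k k' q q' r r' : lbm k -> lbm k' -> lbm q -> lbm q' ->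
    (forall x, a <= x <= b -> `|k x - k' x| <= delta) ->
    (forall x, a <= x <= b -> `|q' x| <= 2 * `|A| * expR (2 * G * (x - a))) ->
    forall x, a <= x <= b ->
    r - r' = \int[mu]_(t in `[a, x]) (k t * q t) - \int[mu]_(t in `[a, x]) (k' t * q' t) ->
    `|r - r' - \int[mu]_(t in `[a, x]) (k t * (q t - q' t))| <=
      delta * (2 * `|A|) / (2 * G) * expR (2 * G * (x - a)).
  move=> lk lk' lq lq' hk hq x xab ->.
  rewrite -!intB; [|by do ?apply: lbmB; apply: lbmM => //; exact: lbmB..
                   |by apply: lbmM => //; exact: lbmB|exact: lbmM|exact: lbmM].
  apply: (le_int_weight (b := b)) => //.
  - by rewrite mulr_ge0// mulr_ge0.
  - by do ?apply: lbmB; apply: lbmM => //; exact: lbmB.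
  - move=> t tab; have -> : k t * q t - k' t * q' t - k t * (q t - q' t) =
      (k t - k' t) * q' t by ring.
    by rewrite normrM -mulrA; apply: ler_pM => //; [exact: hk|exact: hq].
apply: (volterra_stability (f := f) (g := g)) => //.
- by rewrite divr_ge0// ?mulr_ge0// ltW.
- exact: lbmB.
- exact: lbmB.
- by move=> x /hf[].
- by move=> x /hg[].
- move=> x xab; apply: (key g g' p p') => //.
  + by move=> y /hg[_ []].
  + by move=> y /bd'[].
  + by rewrite hv// hv'//; ring.
- move=> x xab; apply: (key f f' v v') => //.
  + by move=> y /hf[_ []].
  + by move=> y /bd'[].
  + by rewrite hp// hp'//; ring.
Qed.

(** Picard iteration gives a limit on [[a, b]]. As [f] vanishes off the window, the product of [f]
    with that limit is meaningful on the whole line, and two successive integrations from [a] extend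
    [p] and then [v] to the whole line. *)
Lemma volterra_exists a b f g (A : R) : a <= b -> lbm f -> lbm g ->
  (forall x, ~~ (a < x < b) -> f x = 0) ->
  exists v p, [/\ AC_with_deriv v (fun x => g x * p x),
    AC_with_deriv p (fun x => f x * v x), lbm v, lbm p &
    forall x, x <= a -> v x = A /\ p x = 0].
Proof.
move=> ab lf lg f0.
pose T (s : (R -> R) * (R -> R)) : (R -> R) * (R -> R) :=
  (fun x => A + prim a (fun t => g t * s.2 t) x, prim a (fun t => f t * s.1 t)).
pose s n := iter n T (fun=> 0, fun=> 0).
have ls n : lbm (s n).1 /\ lbm (s n).2.
  elim: n => [|n [h1 h2]]; first by split; exact: lbm_cst.
  have l1 : lbm (fun t => g t * (s n).2 t) by exact: lbmM.
  have l2 : lbm (fun t => f t * (s n).1 t) by exact: lbmM.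
  split; last exact: AC_lbm (AC_prim a l2).
  by apply: lbmD; [exact: lbm_cst|exact: AC_lbm (AC_prim a l1)].
have [G [G0 hf hg]] : exists G : R, [/\ 0 < G,
    forall x, a <= x <= b -> `|f x| <= G & forall x, a <= x <= b -> `|g x| <= G].
  have [M1 fM] := lf.2 (`|a| + `|b|); have [M2 gM] := lg.2 (`|a| + `|b|).
  have inb z : a <= z <= b -> `|z| <= `|a| + `|b|.
    have := ler_norm (- a); have := ler_norm b; rewrite normrN.
    by have := normr_ge0 a; have := normr_ge0 b; rewrite ler_norml; lra.
  have h3 := ler_norm M1; have h4 := ler_norm M2.
  have h5 := normr_ge0 M1; have h6 := normr_ge0 M2.
  exists (`|M1| + `|M2| + 1); split; first lra.
    by move=> x /inb/fM; lra.
  by move=> x /inb/gM; lra.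
pose w x := expR (2 * G * (x - a)).
have inc n : forall x, a <= x <= b ->
   `|(s n.+1).1 x - (s n).1 x| <= `|A| / 2 ^+ n * w x /\
   `|(s n.+1).2 x - (s n).2 x| <= `|A| / 2 ^+ n * w x.
  elim: n => [|n ih] x xab.
    case/andP: (xab) => ax xb.
    have z1 (k : R -> R) : prim a (fun t => k t * 0) x = 0.
      rewrite prim_ge// (_ : (fun t => k t * 0) = (fun=> 0)) ?int_cst ?mul0r//.
      by apply/funext => t; rewrite mulr0.
    rewrite /s /= !z1 addr0 !subr0 normr0 expr0 divr1; split.
      by rewrite ler_peMr//; apply: weight_ge1 => //; rewrite mulr_ge0// ltW.
    by rewrite mulr_ge0// expR_ge0.
  case/andP: (xab) => ax xb.
  have D0 : 0 <= `|A| / 2 ^+ n by rewrite divr_ge0// exprn_ge0.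
  have -> : `|A| / 2 ^+ n.+1 = `|A| / 2 ^+ n / 2.
    by rewrite exprS; field; rewrite expf_neq0.
  have [l1 l2] := ls n; have [l3 l4] := ls n.+1.
  split.
    have -> : (s n.+2).1 x - (s n.+1).1 x =
        \int[mu]_(t in `[a, x]) (g t * ((s n.+1).2 t - (s n).2 t)).
      rewrite (_ : (fun t => g t * _) = (fun t => g t * (s n.+1).2 t - g t * (s n).2 t)).
        rewrite intB; [|exact: lbmM|exact: lbmM].
        by rewrite [in LHS]/s /= !prim_ge//; rewrite /s/=; ring.
      by apply/funext => t; ring.
    apply: (volterra_contract (b := b)) => //; first exact: lbmB.
    by move=> t /ih[].
  have -> : (s n.+2).2 x - (s n.+1).2 x =
      \int[mu]_(t in `[a, x]) (f t * ((s n.+1).1 t - (s n).1 t)).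
    rewrite (_ : (fun t => f t * _) = (fun t => f t * (s n.+1).1 t - f t * (s n).1 t)).
      rewrite intB; [|exact: lbmM|exact: lbmM].
      by rewrite [in LHS]/s /= !prim_ge//; rewrite /s/=; ring.
    by apply/funext => t; ring.
  apply: (volterra_contract (b := b)) => //; first exact: lbmB.
  by move=> t /ih[].
(* Cutting the iterates off outside the window makes them converge at every point, so that the limit
   is measurable on the whole line. *)
pose ind x : R := if a <= x <= b then 1 else 0.
have mind : measurable_fun setT ind.
  apply: measurable_fun_ifT => //.
  apply: measurable_and; apply: measurable_fun_ler => //.
have limit (q : nat -> R -> R) : (forall n, lbm (q n)) ->
    (forall n x, a <= x <= b -> `|q n.+1 x - q n x| <= `|A| / 2 ^+ n * w x) ->
    exists l, lbm l /\
      forall n x, a <= x <= b -> `|l x - q n x| <= 2 * `|A| / 2 ^+ n * w x.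
  move=> lq hq.
  have /choice[l hl] : forall x, exists l : R, forall n,
      `|l - ind x * q n x| <= 2 * (`|A| * (ind x * w x)) / 2 ^+ n.
    move=> x; apply: geo_increments_lim => n.
    rewrite /ind; case: ifP => [xab|_]; last by rewrite !mul0r subrr normr0 mulr0 mul0r.
    by rewrite !mul1r mulrAC; exact: hq.
  have hl' n x : a <= x <= b -> `|l x - q n x| <= 2 * `|A| / 2 ^+ n * w x.
    move=> xab; have := hl x n; rewrite /ind xab !mul1r.
    by rewrite (_ : 2 * (`|A| * w x) / 2 ^+ n = 2 * `|A| / 2 ^+ n * w x)//; ring.
  exists l; split => //; split.
    apply: (@measurable_fun_cvg _ _ _ _ (fun n x => ind x * q n x)).
      by move=> n; apply: measurable_funM => //; case: (lq n).
    move=> x _; apply/cvgrPdist_le => e e0.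
    have := @cvg_geometric R (2 * (`|A| * (ind x * w x))) 2^-1.
    rewrite ger0_norm ?invr_ge0// invf_lt1// ltr1n => /(_ isT)/cvgrPdist_le/(_ e e0).
    apply: filterS => n; rewrite sub0r normrN /geometric/= exprVn => h.
    exact: le_trans (hl x n) (le_trans (ler_norm _) h).
  move=> c.
  have [M1 hM1] := (lq 0%N).2 (`|a| + `|b|).
  exists (`|M1| + 2 * `|A| * w b) => x _.
  have [xab|xab] := boolP (a <= x <= b).
    have h1 := hl' 0%N x xab; rewrite expr0 divr1 in h1.
    have xb : w x <= w b.
      rewrite ler_expR; case/andP: xab => _ xb; apply: ler_wpM2l; last by rewrite lerD2r.
      by rewrite mulr_ge0// ltW.
    have inb : `|x| <= `|a| + `|b|.
      have := ler_norm (- a); have := ler_norm b; rewrite normrN.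
      by move: xab; have := normr_ge0 a; have := normr_ge0 b; rewrite ler_norml; lra.
    have h2 := hM1 x inb; have h3 := ler_norm M1.
    rewrite -[l x](subrK (q 0%N x)) (le_trans (ler_normD _ _))//.
    have : 2 * `|A| * w x <= 2 * `|A| * w b by apply: ler_wpM2l => //; rewrite mulr_ge0.
    lra.
  have := hl x 0%N; rewrite /ind (negbTE xab) !mul0r !mulr0 mul0r subr0.
  move=> /le_trans; apply; rewrite addr_ge0// !mulr_ge0// expR_ge0//.
have [v1 [lv1 hv1]] := limit (fun n => (s n).1) (fun n => (ls n).1)
  (fun n x xab => (inc n x xab).1).
have [p1 [lp1 hp1]] := limit (fun n => (s n).2) (fun n => (ls n).2)
  (fun n x xab => (inc n x xab).2).
(* Here [u1] is the limit of the iterates [q], while [u] is one Volterra step applied to a limit and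
   therefore stays close to the next iterate; the two must agree. *)
have eqlim (u u1 : R -> R) (q : nat -> R) x : a <= x <= b ->
    (forall n, `|u1 x - q n| <= 2 * `|A| / 2 ^+ n * w x) ->
    (forall n, `|u x - q n.+1| <= 2 * `|A| / 2 ^+ n * w x) -> u x = u1 x.
  move=> xab h1 h2; apply/eqP; rewrite -subr_eq0 -normr_le0.
  apply: (@le_geo_cvg0 _ (4 * `|A| * w x)) => n; rewrite addr0.
  have h3 := h1 n.+1; have h4 := h2 n.
  have h5 : 2 * `|A| / 2 ^+ n.+1 * w x <= 2 * `|A| / 2 ^+ n * w x.
    apply: ler_wpM2r; first exact: expR_ge0.
    apply: ler_wpM2l; first by rewrite mulr_ge0.
    by rewrite lef_pV2 ?posrE ?exprn_gt0// ler_eXn2l// ltr1n.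
  rewrite (_ : u x - u1 x = (u x - q n.+1) - (u1 x - q n.+1)); last by ring.
  rewrite (le_trans (ler_normB _ _))//.
  rewrite (_ : 4 * `|A| * w x / 2 ^+ n = 2 * (2 * `|A| / 2 ^+ n * w x)); last by ring.
  lra.
pose p := prim a (fun t => f t * v1 t).
have lfv1 : lbm (fun t => f t * v1 t) by exact: lbmM.
have ACp : AC_with_deriv p (fun t => f t * v1 t) by exact: AC_prim.
have lp : lbm p by exact: AC_lbm ACp.
have contr (k : R -> R) (u : R -> R) (q : R -> R) n x : lbm k -> lbm u -> lbm q ->
    (forall x, a <= x <= b -> `|k x| <= G) -> a <= x <= b ->
    (forall x, a <= x <= b -> `|u x - q x| <= 2 * `|A| / 2 ^+ n * w x) ->
    `|prim a (fun t => k t * u t) x - prim a (fun t => k t * q t) x| <=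
      2 * `|A| / 2 ^+ n * w x.
  move=> lk lu lq hk xab huq; case/andP: (xab) => ax xb.
  rewrite !prim_ge// -intB; [|exact: lbmM|exact: lbmM].
  rewrite (_ : (fun t => _) = (fun t => k t * (u t - q t))); last first.
    by apply/funext => t; ring.
  have D0 : 0 <= 2 * `|A| / 2 ^+ n by rewrite divr_ge0// ?mulr_ge0// exprn_ge0.
  apply: (le_trans (volterra_contract (b := b) G0 D0 lk (lbmB lu lq) hk huq xab)).
  by apply: ler_wpM2r; [exact: expR_ge0|lra].
have p1E x : a <= x <= b -> p x = p1 x.
  move=> xab; apply: (eqlim p p1 (fun n => (s n).2 x)) => // n; first exact: hp1.
  by apply: contr => //; [exact: (ls n).1|exact: hv1].
pose v x := A + prim a (fun t => g t * p t) x.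
have lgp : lbm (fun t => g t * p t) by exact: lbmM.
have ACv : AC_with_deriv v (fun t => g t * p t).
  apply: AC_ext (ACD (lbm_cst 0) lgp (AC_cst A) (AC_prim a lgp)) => x.
  by rewrite add0r.
have lv : lbm v by exact: AC_lbm ACv.
have v1E x : a <= x <= b -> v x = v1 x.
  move=> xab; apply: (eqlim v v1 (fun n => (s n).1 x)) => // n; first exact: hv1.
  rewrite /v /s /= (_ : A + _ - (A + _) = prim a (fun t => g t * p t) x -
    prim a (fun t => g t * (s n).2 t) x); last by rewrite /s; ring.
  apply: contr => //; first exact: (ls n).2.
  by move=> y yab; rewrite p1E//; exact: hp1.
(* Off the window both sides vanish with [f], so the equation for [p] holds on the whole line with
   [v] itself. *)
have fvE x : f x * v1 x = f x * v x.
  have [xab|xab] := boolP (a < x < b); last by rewrite f0// !mul0r.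
  by rewrite v1E//; case/andP: xab => /ltW -> /ltW ->.
have p0 x : x <= a -> p x = 0.
  move=> xa; rewrite /p prim_le// (_ : \int[mu]_(t in _) _ = 0) ?oppr0//.
  rewrite (@eq_int _ _ _ _ (fun=> 0)) ?int_cst ?mul0r// => t /andP[_ ta].
  by rewrite f0 ?mul0r// negb_and -leNgt ta.
exists v, p; split => //.
  exact: AC_ext ACp.
move=> x xa; split; last exact: p0.
rewrite /v prim_le// (_ : \int[mu]_(t in _) _ = 0) ?oppr0 ?addr0//.
rewrite (@eq_int _ _ _ _ (fun=> 0)) ?int_cst ?mul0r// => t /andP[_ ta].
by rewrite p0 ?mulr0.
Qed.

End volterra_system.

(** * Change of scale in Lebesgue integrals *)

Section scaling.
Set Implicit Arguments. Unset Strict Implicit. Unset Printing Implicit Defensive.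
Context {R : realType}.
Implicit Types f g : R -> R.
Local Notation mu := (@lebesgue_measure R).

(** The pushforward by multiplication by [c] divides lengths by [c] and [mscale] restores them;
    agreement on half-open intervals characterizes Lebesgue measure. *)
Lemma lebesgue_measure_scale (c : R) (c0 : 0 < c) (A : set R) : measurable A ->
  mu A = pushforward (mscale (NngNum (ltW c0)) mu)
    (fun x : R => (c * x : measurableTypeR R)) A.
Proof.
have mc : measurable_fun setT (fun x : R => (c * x : measurableTypeR R)).
  exact: measurable_funM.
move=> mA; apply: lebesgue_measure_unique => //= _ [[a b]] _ <-.
rewrite /pushforward /mscale/=.
rewrite (_ : _ @^-1` _ = `](a / c), (b / c)]%classic); last first.
  by apply/seteqP; split => x /=; rewrite !in_itv/= ltr_pdivrMr// ler_pdivlMr// mulrC.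
rewrite !lebesgue_measure_itv/= !lte_fin ltr_pM2r ?invr_gt0//.
case: ifP => _; last by rewrite mule0.
by rewrite -!EFinB -EFinM; congr EFin; field; exact: lt0r_neq0.
Qed.

Lemma ge0_integral_scale (c : R) (g : R -> \bar R) : 0 < c ->
  measurable_fun setT g -> (forall x, (0 <= g x)%E) ->
  (\int[mu]_x g x = c%:E * \int[mu]_x g (c * x)%R)%E.
Proof.
move=> c0 mg g0.
have mc : measurable_fun setT (fun x : R => (c * x : measurableTypeR R)).
  exact: measurable_funM.
transitivity (\int[pushforward (mscale (NngNum (ltW c0)) mu)
    (fun x : R => ((c * x)%R : measurableTypeR R))]_x g x)%E.
  by apply: eq_measure_integral => A mA _; exact: lebesgue_measure_scale.
rewrite ge0_integral_pushforward// preimage_setT ge0_integral_mscale//.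
  exact: measurableT_comp.
by move=> x _; exact: g0.
Qed.

Lemma int_compact f (b : R) : lbm f -> (forall x, b < `|x| -> f x = 0) ->
  mu.-integrable setT (EFin \o f) /\
  \int[mu]_x f x = \int[mu]_(x in `[- b, b]) f x.
Proof.
move=> lf f0.
have fE : f = f \_ `[- b, b].
  apply/funext => x; rewrite patchE; case: ifPn => //.
  rewrite notin_setE/= in_itv/= => /negP xb; apply: f0.
  by rewrite ltNge ler_norml.
split; last by rewrite [RHS]Rintegral_mkcond -fE.
have := lbm_integrable (- b) b lf; rewrite integrable_mkcond//.
by rewrite restrict_EFin -fE.
Qed.

Lemma int_scale f (c b : R) : 0 < c -> lbm f -> (forall x, b < `|x| -> f x = 0) ->
  \int[mu]_x f x = c * \int[mu]_x f (c * x).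
Proof.
move=> c0 lf f0.
have [intf _] := int_compact lf f0.
have mc : measurable_fun setT (fun x : R => c * x) by exact: measurable_funM.
have lfc : lbm (fun x => f (c * x)).
  split; first by apply: measurableT_comp => //; exact: lf.1.
  move=> B; have [M hM] := lf.2 (c * B); exists M => x xB; apply: hM.
  by rewrite normrM gtr0_norm// ler_pM2l.
have fc0 x : b / c < `|x| -> f (c * x) = 0.
  by rewrite ltr_pdivrMr// => bx; apply: f0; rewrite normrM gtr0_norm// mulrC.
have [intfc _] := int_compact lfc fc0.
transitivity (fine (c%:E * \int[mu]_x (f (c * x)%R)%:E)%E); last first.
  by rewrite fineM//; exact: integrable_fin_num.
rewrite /Rintegral; congr fine; rewrite integralE [in RHS]integralE.
rewrite muleBr//; last first.
  apply: fin_num_adde_defr; apply: integrable_fin_num => //.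
  exact: integrable_funepos.
congr (_ - _)%E.
  rewrite [LHS](ge0_integral_scale c0)//.
    congr (_ * _)%E; apply: eq_integral => x _.
    by have := congr1 (fun F => F x) (funepos_comp (EFin \o f) (fun x => c * x)).
  by apply: measurable_funepos; exact: measurable_int intf.
rewrite [LHS](ge0_integral_scale c0)//.
  congr (_ * _)%E; apply: eq_integral => x _.
  by have := congr1 (fun F => F x) (funeneg_comp (EFin \o f) (fun x => c * x)).
by apply: measurable_funeneg; exact: measurable_int intf.
Qed.

End scaling.

(** * Square integrability from exponential decay *)

Section exponential_decay.
Set Implicit Arguments. Unset Strict Implicit. Unset Printing Implicit Defensive.
Context {R : realType}.
Implicit Types f g : R -> R.
Local Notation mu := (@lebesgue_measure R).

(** By evenness the integral is twice that over the half-line, where the integrand is [k^-1] times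
    the density of the exponential law. *)
Lemma integrable_expNabs (k : R) : 0 < k ->
  mu.-integrable setT (fun x => (expR (- k * `|x|))%:E).
Proof.
move=> k0.
have ce : continuous (fun x : R => expR (- k * `|x|)).
  move=> x; apply: (@continuous_comp _ _ _ (fun x : R => `|x|) (fun y => expR (- k * y))).
    exact: norm_continuous.
  exact: continuous_expZ.
apply/integrableP; split.
  by apply/measurable_EFinP; exact: (continuous_measurable_fun ce).
under eq_integral do rewrite gee0_abs ?lee_fin ?expR_ge0//.
rewrite ge0_symfun_integralT//; last by move=> x /=; rewrite normrN.
have mp : measurable [set x : R | 0 <= x] by rewrite -set_itvcy.
apply: lte_mul_pinfty => //.
have h : mu.-integrable [set x : R | 0 <= x]
    (fun x => (k^-1)%:E * (exponential_pdf k x)%:E)%E.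
  apply: integrableZl => //; apply: (@integrableS _ _ _ _ setT) => //.
  exact: integrable_exponential_pdf.
have /integrableP[_] := h; apply: le_lt_trans.
rewrite le_eqVlt; apply/orP; left; apply/eqP; apply: eq_integral => x; rewrite inE/= => x0.
rewrite exponential_pdfE// mulrA mulVf ?mul1r ?lt0r_neq0//.
by rewrite !ger0_norm ?expR_ge0.
Qed.

Lemma L2_exp_decay f (b C k : R) : 0 < k -> lbm f ->
  (forall x, b <= `|x| -> `|f x| <= C * expR (- k * `|x|)) -> L2 f.
Proof.
move=> k0 lf hf; rewrite /L2.
have [M hM] := lf.2 b.
(* On [|x| <= b] the exponential is at least [expR (- k * b)], so the factor [expR (k * b)] lets it
   dominate the local bound [M]. *)
pose B := `|C| + `|M| * expR (k * b).
have hB x : `|f x| <= B * expR (- k * `|x|).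
  have [bx|/ltW xb] := leP b `|x|.
    apply: (le_trans (hf x bx)); apply: ler_wpM2r; first exact: expR_ge0.
    by rewrite (le_trans (ler_norm C))// lerDl mulr_ge0// expR_ge0.
  apply: (le_trans (hM x xb)).
  rewrite mulrDl -mulrA -expRD mulNr -mulrBr.
  have h1 : 1 <= expR (k * (b - `|x|)) by apply: weight_ge1 => //; exact: ltW.
  have h2 : `|M| <= `|M| * expR (k * (b - `|x|)) by rewrite ler_peMr.
  have h3 : 0 <= `|C| * expR (- (k * `|x|)) by rewrite mulr_ge0// expR_ge0.
  have := ler_norm M; lra.
have := @integrableZl _ _ _ mu setT measurableT (B ^+ 2) _ (integrable_expNabs (mulr_gt0 (ltr0n _ 2) k0)).
apply: le_integrable => //.
  apply/measurable_EFinP; apply: measurable_funX; exact: lf.1.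
move=> x _; rewrite -EFinM/= lee_fin normrX.
have -> : B ^+ 2 * expR (- (2 * k) * `|x|) = (B * expR (- k * `|x|)) ^+ 2.
  by rewrite exprMn -[X in _ = _ * X]expRM_natl; congr (_ * expR _); ring.
by rewrite normrX lerXn2r ?nnegrE// (le_trans (hB x))// ler_norm.
Qed.

End exponential_decay.

(** * Half-bound states outside the support of the potential *)

Section half_bound_states.
Set Implicit Arguments. Unset Strict Implicit. Unset Printing Implicit Defensive.
Context {R : realType}.
Implicit Types (U h : R -> R) (r x t : R).
Local Notation mu := (@lebesgue_measure R).

Lemma half_bound_state_AC U h : Linfty_compact U -> half_bound_state U h ->
  [/\ AC_with_deriv h (derive1 h), AC_with_deriv (derive1 h) (fun x => U x * h x),
      lbm h & lbm (derive1 h)].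
Proof.
move=> LU [_ [_ [dh ACh]]].
have ch : continuous h.
  by move=> x; apply/differentiable_continuous/derivable1_diffP.
have lh := lbm_continuous ch.
have lUh : lbm (fun x => U x * h x) by apply: lbmM => //; exact: lbm_Linfty.
have ch' := AC_continuous lUh ACh.
split=> //; last exact: lbm_continuous.
by apply: derive_AC => // x; rewrite derive1E; apply: DeriveDef.
Qed.

Lemma bounded_slope0 (s M : R) : (forall t, 0 <= t -> `|s * t| <= M) -> s = 0.
Proof.
move=> h; apply/eqP; apply/negPn/negP => s0.
have s1 : 0 < `|s| by rewrite normr_gt0.
have M0 : 0 <= M by have := h 0 (lexx _); rewrite mulr0 normr0.
have t0 : 0 <= (M + 1) / `|s| by rewrite divr_ge0// ?addr_ge0.
have := h _ t0; rewrite normrM (ger0_norm t0) mulrC divfK ?gt_eqF//; lra.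
Qed.

(** Where [U] vanishes [h] is affine, and a bounded affine function on a half-line is constant,
    equal to its limit. *)
Lemma half_bound_state_right U h r (hp : R) : Linfty_compact U ->
  half_bound_state U h -> (forall x, r <= x -> U x = 0) ->
  h x @[x --> +oo] --> hp -> forall x, r <= x -> h x = hp /\ derive1 h x = 0.
Proof.
move=> LU hU U0 hhp.
have [AC1 AC2 lh lh'] := half_bound_state_AC LU hU.
have h'c x : r <= x -> derive1 h x = derive1 h r.
  move=> rx; rewrite (AC_int AC2 rx) (@eq_int _ _ _ _ (fun=> 0)) ?int_cst ?mul0r ?addr0//.
  by move=> t /andP[rt _]; rewrite U0// mul0r.
have hc x : r <= x -> h x = h r + derive1 h r * (x - r).
  move=> rx; rewrite (AC_int AC1 rx) (@eq_int _ _ _ _ (fun=> derive1 h r)) ?int_cst//.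
  by move=> t /andP[rt _]; rewrite h'c.
have [M hM] := hU.2.1.
have s0 : derive1 h r = 0.
  apply: (@bounded_slope0 _ (M + M)) => t t0.
  rewrite (_ : derive1 h r * t = h (r + t) - h r); last first.
    by rewrite hc ?lerDl//; ring.
  by rewrite (le_trans (ler_normB _ _))// lerD.
have hr x : r <= x -> h x = h r by move=> rx; rewrite hc// s0 mul0r addr0.
have hrp : h r = hp.
  have : h x @[x --> +oo] --> h r.
    apply: cvg_near_cst; near=> x; apply: hr; near: x; by apply: nbhs_pinfty_ge; exact: num_real.
  by move/cvg_lim <- => //; apply: (cvg_lim _ hhp).
by move=> x rx; rewrite hr// hrp h'c.
Unshelve. all: by end_near. Qed.

Lemma half_bound_state_left U h r (hm : R) : Linfty_compact U ->
  half_bound_state U h -> (forall x, x <= r -> U x = 0) ->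
  h x @[x --> -oo] --> hm -> forall x, x <= r -> h x = hm /\ derive1 h x = 0.
Proof.
move=> LU hU U0 hhp.
have [AC1 AC2 lh lh'] := half_bound_state_AC LU hU.
have h'c x : x <= r -> derive1 h x = derive1 h r.
  move=> rx; rewrite [RHS](AC_int AC2 rx) (@eq_int _ _ _ _ (fun=> 0)) ?int_cst ?mul0r ?addr0//.
  by move=> t /andP[_ rt]; rewrite U0// mul0r.
have hc x : x <= r -> h r = h x + derive1 h r * (r - x).
  move=> rx; rewrite (AC_int AC1 rx) (@eq_int _ _ _ _ (fun=> derive1 h r)) ?int_cst//.
  by move=> t /andP[_ rt]; rewrite h'c.
have [M hM] := hU.2.1.
have s0 : derive1 h r = 0.
  apply: (@bounded_slope0 _ (M + M)) => t t0.
  rewrite (_ : derive1 h r * t = h r - h (r - t)); last first.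
    by rewrite (hc (r - t)) ?gerBl//; ring.
  by rewrite (le_trans (ler_normB _ _))// lerD.
have hr x : x <= r -> h x = h r.
  by move=> rx; rewrite (hc x)// s0 mul0r addr0.
have hrp : h r = hm.
  have : h x @[x --> -oo] --> h r.
    apply: cvg_near_cst; near=> x; apply: hr; near: x; by apply: nbhs_ninfty_le; exact: num_real.
  by move/cvg_lim <- => //; apply: (cvg_lim _ hhp).
by move=> x rx; rewrite hr// hrp h'c.
Unshelve. all: by end_near. Qed.

End half_bound_states.

(** * Jost solutions, and eigenvalues as zeros of the Jost function *)

Section jost_solutions.
Set Implicit Arguments. Unset Strict Implicit. Unset Printing Implicit Defensive.
Context {R : realType}.
Implicit Types (W v p : R -> R) (rho A w x t : R).
Local Notation mu := (@lebesgue_measure R).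

(* [y x = expR (w * x) * v x] solves [- y'' + W y = - w ^+ 2 y] and equals
   [A * expR (w * x)] on the left of the support of [W]; [p] stands for
   [expR (2 * w * x) * v' x]. *)
Definition jost W (rho A w : R) v p :=
  [/\ AC_with_deriv v (fun x => expR (- (2 * w) * x) * p x),
      AC_with_deriv p (fun x => expR (2 * w * x) * W x * v x),
      lbm v, lbm p & forall x, x <= - rho -> v x = A /\ p x = 0].

Lemma jost_exists W (rho A w : R) : 0 <= rho -> lbm W ->
  (forall x, rho <= `|x| -> W x = 0) -> exists v p, jost W rho A w v p.
Proof.
move=> r0 lW W0.
have le : - rho <= rho by lra.
have [||v [p hvp]] := @volterra_exists R (- rho) rho
  (fun x => expR (2 * w * x) * W x) (fun x => expR (- (2 * w) * x)) A le _ (lbm_expZ _).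
- by apply: lbmM => //; exact: lbm_expZ.
- move=> x xr; rewrite W0 ?mulr0// leNgt ltr_norml; exact: xr.
- by exists v, p.
Qed.

Lemma jost_int W rho A w v p : jost W rho A w v p -> forall x, - rho <= x ->
  v x = A + \int[mu]_(t in `[- rho, x]) (expR (- (2 * w) * t) * p t) /\
  p x = \int[mu]_(t in `[- rho, x]) (expR (2 * w * t) * W t * v t).
Proof.
move=> [h1 h2 _ _ h3] x rx; have [<- p0] := h3 (- rho) (lexx _).
by split; [exact: AC_int|rewrite (AC_int h2 rx) p0 add0r].
Qed.

(** On the right of the support [p] is constant, so [v] is a constant minus
    [p rho / (2 * w) * expR (- (2 * w) * x)]. The condition at [rho] says that this constant is
    zero: the growing exponential is absent from [expR (w * x) * v x]. *)
Lemma jost_right W rho A w v p : 0 < w -> 0 <= rho ->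
  (forall x, rho <= `|x| -> W x = 0) -> jost W rho A w v p ->
  p rho + 2 * w * expR (2 * w * rho) * v rho = 0 ->
  forall x, rho <= x -> p x = p rho /\
    v x = v rho * expR (2 * w * rho) * expR (- (2 * w) * x).
Proof.
move=> w0 r0 W0 [h1 h2 lv lp _] F0.
have pc x : rho <= x -> p x = p rho.
  move=> rx; rewrite (AC_int h2 rx) (@eq_int _ _ _ _ (fun=> 0)) ?int_cst ?mul0r ?addr0//.
  by move=> t /andP[rt _]; rewrite W0 ?mulr0 ?mul0r// (le_trans rt)// ler_norm.
move=> x rx; split; first exact: pc.
have hE := ((AC_expZ (- (2 * w))) _ _ rx).2.
rewrite (intZ _ _ _ (lbm_expZ _)) in hE.
rewrite (AC_int h1 rx) (@eq_int _ _ _ _ (fun t => p rho * expR (- (2 * w) * t))); last first.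
  by move=> t /andP[rt _]; rewrite pc// mulrC.
rewrite (intZ _ _ _ (lbm_expZ _)).
have pE : p rho = - (2 * w) * (expR (2 * w * rho) * v rho) by move: F0; lra.
have eI : expR (2 * w * rho) * expR (- (2 * w) * rho) = 1.
  by rewrite -expRD mulNr subrr expR0.
rewrite pE mulrAC -hE.
rewrite mulrBl [X in _ + (_ - X)](_ : _ = v rho * 1); first by ring.
by rewrite mulrA [X in X * _]mulrC eI mulrC.
Qed.

(** Outside the window [y] is a multiple of [expR (- w * |x|)] on either side, and its first two
    derivatives are multiples of [y] there, so all three are square integrable. *)
Lemma jost_eigenvalue W rho A w v p : 0 < w -> 0 <= rho -> A != 0 -> lbm W ->
  (forall x, rho <= `|x| -> W x = 0) -> jost W rho A w v p ->
  p rho + 2 * w * expR (2 * w * rho) * v rho = 0 ->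
  is_eigenvalue W (- w ^+ 2).
Proof.
move=> w0 r0 A0 lW W0 J F0.
have right := jost_right w0 r0 W0 J F0.
have [h1 h2 lv lp h3] := J.
pose y (x : R) : R := expR (w * x) * v x.
(* [y1] is the derivative of [y], because [expR (w * x) * v'] equals [expR (- w * x) * p]; [y2] is
   the second derivative that the equation prescribes, so the equation holds at every point. *)
pose y1 (x : R) : R := w * y x + expR (- w * x) * p x.
pose y2 (x : R) : R := (W x + w ^+ 2) * y x.
have ly : lbm y by apply: lbmM => //; exact: lbm_expZ.
have lep : lbm (fun x => expR (- w * x) * p x) by apply: lbmM => //; exact: lbm_expZ.
have ly1 : lbm y1 by apply: lbmD => //; exact: lbmZ.
have ly2 : lbm y2.
  by apply: lbmM => //; apply: lbmD => //; exact: lbm_cst.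
have ACy : AC_with_deriv y y1.
  apply: AC_ext (ACM _ _ (AC_expZ w) h1).
  - move=> x; rewrite /y1 /y mulrA -expRD; congr (_ + expR _ * _); ring.
  - by apply: lbmZ; exact: lbm_expZ.
  - by apply: lbmM => //; exact: lbm_expZ.
have ACy1 : AC_with_deriv y1 y2.
  have l1 : lbm (fun x => - w * expR (- w * x)) by apply: lbmZ; exact: lbm_expZ.
  have l2 : lbm (fun x => expR (2 * w * x) * W x * v x).
    by apply: lbmM => //; apply: lbmM => //; exact: lbm_expZ.
  have l3 := lbm_expZ (- w).
  apply: AC_ext (ACD _ _ (ACZ w ly1 ACy) (ACM l1 l2 (AC_expZ (- w)) h2)).
  - move=> x; rewrite /y2 /y1 /y.
    have -> : expR (w * x) = expR (- w * x) * expR (2 * w * x).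
      by rewrite -expRD; congr expR; ring.
    ring.
  - exact: lbmZ.
  - by apply: lbmD; exact: lbmM.
have dy x : is_derive x 1 y (y1 x).
  by apply: AC_derive => //; exact: (AC_continuous ly2 ACy1).
have y1E : derive1 y = y1.
  by apply/funext => x; rewrite derive1E; have dyx := dy x; rewrite derive_val.
pose c := v rho * expR (2 * w * rho).
pose C := `|A| + `|c|.
have outl x : x <= - rho -> y x = A * expR (- w * `|x|) /\ y1 x = w * y x.
  move=> xr; have [vx px] := h3 x xr.
  have x0 : `|x| = - x by rewrite ler0_norm//; lra.
  by rewrite /y1 /y vx px x0 mulr0 addr0 mulrNN mulrC.
have outr x : rho <= x -> y x = c * expR (- w * `|x|) /\ y1 x = - w * y x.
  move=> rx; have [px vx] := right x rx.
  have x0 : `|x| = x by rewrite ger0_norm//; lra.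
  have yx : y x = c * expR (- w * x).
    rewrite /y vx /c mulrCA -expRD; congr (_ * expR _); ring.
  rewrite x0; split => //; rewrite /y1 yx px.
  have -> : p rho = - (2 * w) * c by rewrite /c; move: F0; lra.
  by ring.
have outy x : rho <= `|x| -> `|y x| <= C * expR (- w * `|x|) /\ `|y1 x| = w * `|y x|.
  rewrite ler_normr => /orP[|xr].
    move=> /outr[yx ->]; split; last by rewrite normrM normrN (gtr0_norm w0).
    rewrite yx normrM (ger0_norm (expR_ge0 _)); apply: ler_wpM2r; first exact: expR_ge0.
    by rewrite lerDr.
  have /outl[yx ->] : x <= - rho by lra.
  split; last by rewrite normrM (gtr0_norm w0).
  rewrite yx normrM (ger0_norm (expR_ge0 _)); apply: ler_wpM2r; first exact: expR_ge0.
  by rewrite lerDl.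
have L2y : L2 y by apply: (@L2_exp_decay _ _ rho C w) => // x /outy[].
have L2y1 : L2 y1.
  apply: (@L2_exp_decay _ _ rho (w * C) w) => // x /outy[h ->].
  by rewrite -mulrA; apply: ler_wpM2l => //; exact: ltW.
have L2y2 : L2 y2.
  apply: (@L2_exp_decay _ _ rho (w ^+ 2 * C) w) => // x xr; have [h _] := outy x xr.
  rewrite /y2 W0// add0r normrM ger0_norm ?sqr_ge0// -mulrA.
  by apply: ler_wpM2l => //; exact: sqr_ge0.
exists y, y2; rewrite y1E; split.
  exists (- rho); have [-> _] := outl (- rho) (lexx _).
  by rewrite mulf_neq0// gt_eqF// expR_gt0.
split; first by move=> x; have [] := dy x.
do 4 (split; first by []).
by apply: aeW => x; rewrite /y2; ring.
Qed.

End jost_solutions.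

(** * Continuity of the Jost function in the spectral parameter *)

Section jost_continuity.
Set Implicit Arguments. Unset Strict Implicit. Unset Printing Implicit Defensive.
Context {R : realType}.
Implicit Types (W v p : R -> R) (rho A w x t : R).
Local Notation mu := (@lebesgue_measure R).

Lemma expR_lip (a b M : R) : expR a <= M -> expR b <= M ->
  `|expR a - expR b| <= M * `|a - b|.
Proof.
wlog ab : a b / b <= a => [hw ha hb|ha _].
  by have [ba|/ltW ab] := leP b a; [exact: hw|rewrite distrC (distrC a); exact: hw].
rewrite !ger0_norm ?subr_ge0 ?ler_expR//.
have -> : expR a - expR b = expR a * (1 - expR (b - a)).
  by rewrite mulrBr mulr1 -expRD addrCA subrr addr0.
have h1 := expR_ge1Dx (b - a).
have h2 : expR (b - a) <= 1 by rewrite -expR0 ler_expR; lra.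
by apply: ler_pM => //; lra.
Qed.

Lemma exp_window rho w x : `|x| <= rho -> `|w| <= 1 ->
  expR (2 * w * x) <= expR (2 * rho) /\ expR (- (2 * w) * x) <= expR (2 * rho).
Proof.
move=> hx hw; have h : `|2 * w * x| <= 2 * rho.
  rewrite !normrM (ger0_norm (ler0n _ 2)) -mulrA; apply: ler_wpM2l => //.
  by rewrite -[rho]mul1r; exact: ler_pM.
split; rewrite ler_expR; first exact: le_trans (ler_norm _) h.
by rewrite mulNr (le_trans (ler_norm _))// normrN.
Qed.

(** The two systems share the initial value [A] and differ through exponentials that are Lipschitz
    in [w] on the window. The constant does not depend on the solutions, so these may be chosen
    separately for each [w] and still depend continuously on it. *)
Lemma jost_lipschitz W rho A : 0 <= rho -> lbm W ->
  exists C : R, forall w w' v p v' p', `|w| <= 1 -> `|w'| <= 1 ->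
    jost W rho A w v p -> jost W rho A w' v' p' ->
    `|v rho - v' rho| <= C * `|w - w'| /\ `|p rho - p' rho| <= C * `|w - w'|.
Proof.
move=> r0 lW; have [M0 hM0] := lW.2 rho.
pose M := `|M0|; have hM x : `|x| <= rho -> `|W x| <= M.
  by move=> /hM0/le_trans; apply; exact: ler_norm.
have Mge0 : 0 <= M by exact: normr_ge0.
pose E := expR (2 * rho); have E1 : 1 <= E by rewrite -expR0 ler_expR; lra.
(* [G] bounds both coefficients and [D] is a Lipschitz constant in [w] for both; the [+ 1] lets them
   serve for the coefficient without [W] as well. *)
pose G := E * (M + 1); have G0 : 0 < G by rewrite mulr_gt0; lra.
pose D := E * (2 * rho) * (M + 1).
have D0 : 0 <= D by rewrite !mulr_ge0//; lra.
exists (2 * (D * (2 * `|A|) / (2 * G)) * expR (2 * G * (rho - - rho))).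
move=> w w' v p v' p' hw hw' J J'.
have [_ _ lv lp _] := J; have [_ _ lv' lp' _] := J'.
have ab x : - rho <= x <= rho -> `|x| <= rho by rewrite ler_norml.
have bd w0 x : `|w0| <= 1 -> `|x| <= rho ->
    `|expR (2 * w0 * x) * W x| <= G /\ `|expR (- (2 * w0) * x)| <= G.
  move=> hw0 hx; have [e1 e2] := exp_window hx hw0.
  rewrite normrM !(ger0_norm (expR_ge0 _)); split.
    apply: ler_pM => //.
    by rewrite (le_trans (hM x hx))// lerDl.
  by rewrite (le_trans e2)// ler_peMr ?expR_ge0//; lra.
(* The sign [s] treats both exponents at once. *)
have df s x : `|s * w| <= 1 -> `|s * w'| <= 1 -> `|s| = 1 -> `|x| <= rho ->
    `|expR (2 * (s * w) * x) - expR (2 * (s * w') * x)| <= E * (2 * rho) * `|w - w'|.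
  move=> sw sw' s1 hx; have [e1 _] := exp_window hx sw; have [e2 _] := exp_window hx sw'.
  apply: (le_trans (expR_lip e1 e2)).
  rewrite -[X in _ <= X]mulrA; apply: ler_wpM2l; first exact: expR_ge0.
  have -> : 2 * (s * w) * x - 2 * (s * w') * x = 2 * (s * (w - w') * x) by ring.
  rewrite !normrM s1 mul1r (ger0_norm (ler0n _ 2)) -mulrA; apply: ler_wpM2l => //.
  by rewrite mulrC; apply: ler_wpM2r.
have wt0 : 0 <= `|w - w'| by exact: normr_ge0.
have delta0 : 0 <= D * `|w - w'| by rewrite mulr_ge0.
have := @volterra_perturbation R (- rho) rho G (D * `|w - w'|)
  (fun x => expR (2 * w * x) * W x) (fun x => expR (- (2 * w) * x)) v p
  (fun x => expR (2 * w' * x) * W x) (fun x => expR (- (2 * w') * x)) v' p' A G0 delta0.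
have lf w0 : lbm (fun x => expR (2 * w0 * x) * W x).
  by apply: lbmM => //; exact: lbm_expZ.
move=> /(_ (lf w) (lbm_expZ _) lv lp (lf w') (lbm_expZ _) lv' lp').
have hrho : - rho <= rho <= rho by lra.
have cE : forall c : R, 2 * (D * c * (2 * `|A|) / (2 * G)) * expR (2 * G * (rho - - rho)) =
   2 * (D * (2 * `|A|) / (2 * G)) * expR (2 * G * (rho - - rho)) * c by move=> c; ring.
rewrite -cE; apply => //.
- move=> x /ab hx; split; first by case: (bd w x hw hx).
  split; first by case: (bd w' x hw' hx).
  rewrite -mulrBl normrM (_ : D * _ = E * (2 * rho) * `|w - w'| * (M + 1)); last first.
    by rewrite /D; ring.
  apply: ler_pM => //; last by rewrite (le_trans (hM x hx))// lerDl.
  by have := df 1 x; rewrite !mul1r normr1; exact.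
- move=> x /ab hx; split; first by case: (bd w x hw hx).
  split; first by case: (bd w' x hw' hx).
  have := df (-1) x; rewrite !mulN1r !mulrN !normrN normr1 => /(_ hw hw' erefl hx).
  move=> /le_trans; apply; rewrite [X in _ <= X]mulrAC ler_peMr//; last lra.
  by rewrite !mulr_ge0//; lra.
- by move=> x /andP[hx _]; case: (jost_int J hx).
- by move=> x /andP[hx _]; case: (jost_int J hx).
- by move=> x /andP[hx _]; case: (jost_int J' hx).
- by move=> x /andP[hx _]; case: (jost_int J' hx).
Qed.

Lemma continuous_of_lip (F : R -> R) (C w0 : R) : `|w0| < 1 ->
  (forall w w', `|w| <= 1 -> `|w'| <= 1 -> `|F w - F w'| <= C * `|w - w'|) ->
  {for w0, continuous F}.
Proof.
move=> hw0 hF; apply/cvgrPdist_le => e e0; near=> w.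
have hw : `|w| <= 1.
  have : `|w0 - w| <= 1 - `|w0|.
    by near: w; apply: cvgr_dist_le => //; rewrite subr_gt0.
  have := ler_normB w0 (w0 - w); rewrite subKr; lra.
have he : `|w0 - w| <= e / (`|C| + 1).
  by near: w; apply: cvgr_dist_le => //; rewrite divr_gt0// ltr_wpDl.
apply: (le_trans (hF _ _ (ltW hw0) hw)).
move: he; rewrite ler_pdivlMr ?ltr_wpDl// => he; apply: le_trans he.
rewrite mulrC; apply: ler_wpM2l => //.
by rewrite (le_trans (ler_norm _))// lerDl.
Unshelve. all: by end_near. Qed.

Lemma jost_function_continuous W rho A (v p : R -> R -> R) :
  0 <= rho -> lbm W -> (forall w, jost W rho A w (v w) (p w)) ->
  forall w0, `|w0| < 1 ->
  {for w0, continuous (fun w => p w rho + 2 * w * expR (2 * w * rho) * v w rho)}.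
Proof.
move=> r0 lW J w0 hw0; have [C hC] := jost_lipschitz A r0 lW.
have cv : {for w0, continuous (fun w => v w rho)}.
  by apply: (@continuous_of_lip _ C) => // w w' hw hw'; case: (hC _ _ _ _ _ _ hw hw' (J w) (J w')).
have cp : {for w0, continuous (fun w => p w rho)}.
  by apply: (@continuous_of_lip _ C) => // w w' hw hw'; case: (hC _ _ _ _ _ _ hw hw' (J w) (J w')).
have c2 : {for w0, continuous (fun w : R => 2 * w)} by exact: mulrl_continuous.
have ce : {for w0, continuous (fun w => expR (2 * w * rho))}.
  have -> : (fun w => expR (2 * w * rho)) = (fun w => expR ((2 * rho) * w)).
    by apply/funext => w; congr expR; ring.
  exact: continuous_expZ.
by apply: cvgD => //; apply: cvgM => //; exact: cvgM.
Qed.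

End jost_continuity.

(** * Uniform asymptotics of the Jost function near the resonance *)

Section threshold_asymptotics.
Set Implicit Arguments. Unset Strict Implicit. Unset Printing Implicit Defensive.
Context {R : realType} (U V h h' : R -> R) (rho rV MU MV hm hp : R).
Context (lU : lbm U) (lV : lbm V) (bU : forall x, `|U x| <= MU)
  (bV : forall x, `|V x| <= MV) (U0 : forall x, rho <= `|x| -> U x = 0)
  (V0 : forall x, rV < `|x| -> V x = 0) (rV0 : 0 <= rV) (rVrho : rV < rho).
Context (ACh : AC_with_deriv h h') (ACh' : AC_with_deriv h' (fun x => U x * h x))
  (lh : lbm h) (lh' : lbm h').
Context (hl : h (- rho) = hm) (hl' : h' (- rho) = 0)
  (hr : h rho = hp) (hr' : h' rho = 0).
Context (intV : Rintegral (@lebesgue_measure R) setT V = 0).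
Implicit Types (v p : R -> R) (l al w x t : R).
Local Notation mu := (@lebesgue_measure R).
Local Notation W l al := (fun x => U x + l * al * V (al * x)).
Local Notation IxV := (Rintegral mu setT (fun x => x * V x)).

Ltac nonneg := repeat first [assumption | exact: normr_ge0 | exact: expR_ge0 |
  exact: ler0n | apply: ltW; assumption | rewrite invr_ge0 | apply: mulr_ge0 |
  apply: addr_ge0]; lra.

Let rho0 : 0 < rho. Proof. exact: le_lt_trans rV0 rVrho. Qed.

Let MU0 : 0 <= MU. Proof. exact: le_trans (bU 0). Qed.

Let MV0 : 0 <= MV. Proof. exact: le_trans (bV 0). Qed.

Lemma lbm_scaled al : lbm (fun x => V (al * x)).
Proof.
split; last by move=> b; exists MV.
by apply: measurableT_comp; [exact: lV.1|exact: measurable_funM].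
Qed.

Lemma lbm_potential l al : lbm (W l al).
Proof. by apply: lbmD => //; apply: lbmZ; exact: lbm_scaled. Qed.

Lemma potential_support l al x : 1 <= al -> rho <= `|x| -> U x + l * al * V (al * x) = 0.
Proof.
have rr0 := rVrho.
move=> al1 xr; rewrite U0// V0 ?mulr0 ?addr0//.
rewrite normrM ger0_norm; last lra.
have : `|x| <= al * `|x| by rewrite ler_peMl.
lra.
Qed.

(** Both systems start from [(hm, 0)] at [- rho], and their coefficients differ by a multiple of
    [l * al + w], [V] being bounded. The function compared with [h] is [expR (2 * w * x) * v], since
    this is the factor occurring in the Wronskian identity. *)
Lemma jost_close : exists D B : R, [/\ 0 <= D, 0 <= B &
  forall l al w v p, 0 < l -> 1 <= al -> l * al <= 1 -> 0 <= w <= 1 ->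
  jost (W l al) rho hm w v p -> forall x, - rho <= x <= rho ->
  [/\ `|v x| <= B, `|h x| <= B, `|h' x| <= B & expR (2 * w * x) <= B] /\
  (`|expR (2 * w * x) * v x - h x| <= D * (l * al + w) /\
   `|p x - h' x| <= D * (l * al + w))].
Proof.
have r0 := rho0; have rr0 := rVrho; have u0 := MU0; have v0 := MV0; have rv0 := rV0.
pose E := expR (2 * rho).
have E1 : 1 <= E by rewrite -expR0 ler_expR; lra.
pose G := E * (MU + MV + 1).
have G0 : 0 < G by rewrite mulr_gt0//; lra.
(* Replacing an exponential by 1 costs [E * (2 * rho) * w], multiplied by [MU] or by 1 according to
   the coefficient; the scaled perturbation costs [E * MV * (l * al)]. *)
pose D0 := E * (2 * rho) * (MU + 1) + E * MV.
have D00 : 0 <= D0 by nonneg.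
pose X := expR (2 * G * (rho - - rho)).
have X0 : 0 <= X by exact: expR_ge0.
pose D1 := 2 * (D0 * (2 * `|hm|) / (2 * G)) * X.
have D10 : 0 <= D1 by nonneg.
pose B := E + 2 * `|hm| * X.
have B0 : 0 <= B by nonneg.
(* [D1] compares [v] with [h]; the other term pays for the factor [expR (2 * w * x)] in front of
   [v]. *)
exists (E * (2 * rho) * B + D1), B; split => //.
  by nonneg.
move=> l al w v p l0 al1 la1 w01 J.
have wn : `|w| <= 1 by rewrite ger0_norm; lra.
have la0 : 0 < l * al by rewrite mulr_gt0//; lra.
have [_ _ lv lp _] := J.
have ab x : - rho <= x <= rho -> `|x| <= rho by rewrite ler_norml.
have Xle x : - rho <= x <= rho -> expR (2 * G * (x - - rho)) <= X.
  move=> /andP[_ xr]; rewrite ler_expR; apply: ler_wpM2l; first by rewrite mulr_ge0// ltW.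
  by rewrite lerD2r.
have Wb x : `|U x + l * al * V (al * x)| <= MU + MV.
  rewrite (le_trans (ler_normD _ _))// lerD// normrM (gtr0_norm la0).
  by rewrite -[MV]mul1r; apply: ler_pM => //; exact: ltW.
have m1 x : `|x| <= rho -> `|expR (2 * w * x) - 1| <= E * (2 * rho) * w /\
    `|expR (- (2 * w) * x) - 1| <= E * (2 * rho) * w.
  move=> hx; have [e1 e2] := exp_window hx wn.
  have e3 : expR 0 <= E by rewrite expR0.
  have k : E * `|2 * w * x| <= E * (2 * rho) * w.
    rewrite -[X in _ <= X]mulrA; apply: ler_wpM2l; first exact: expR_ge0.
    rewrite !normrM (ger0_norm (ler0n _ 2)) ger0_norm; last lra.
    by rewrite -!mulrA; apply: ler_wpM2l => //; rewrite mulrC; apply: ler_wpM2r => //; lra.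
  split; apply: le_trans k.
    by have := expR_lip e1 e3; rewrite subr0 expR0.
  by have := expR_lip e2 e3; rewrite subr0 expR0 mulNr normrN.
have E0 : 0 <= E by lra.
have lf : lbm (fun x => expR (2 * w * x) * (U x + l * al * V (al * x))).
  by apply: lbmM; [exact: lbm_expZ|exact: lbm_potential].
have EG : E <= G by rewrite /G ler_peMr//; lra.
have fb x : `|x| <= rho -> `|expR (2 * w * x) * (U x + l * al * V (al * x))| <= G.
  move=> hx; have [e1 e2] := exp_window hx wn.
  rewrite normrM (ger0_norm (expR_ge0 _)); apply: ler_pM => //.
  by apply: (le_trans (Wb x)); rewrite lerDl.
have gb x : `|x| <= rho -> `|expR (- (2 * w) * x)| <= G.
  move=> hx; have [e1 e2] := exp_window hx wn.
  by rewrite (ger0_norm (expR_ge0 _)) (le_trans e2).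
have hint x : - rho <= x -> h x = hm + \int[mu]_(t in `[- rho, x]) (1 * h' t).
  by move=> rx; rewrite (AC_int ACh rx) hl; congr (_ + _); apply: eq_int => t _; rewrite mul1r.
have hint' x : - rho <= x -> h' x = \int[mu]_(t in `[- rho, x]) (U t * h t).
  by move=> rx; rewrite (AC_int ACh' rx) hl' add0r.
have bv := @volterra_bound R (- rho) rho G _ _ v p hm G0 lf (lbm_expZ _) lv lp
  (fun x xr => fb x (ab x xr)) (fun x xr => gb x (ab x xr)).
have {}bv x : - rho <= x <= rho -> `|v x| <= 2 * `|hm| * X.
  move=> xr; have [] := bv _ _ x xr.
  - by move=> y /andP[yr _]; case: (jost_int J yr).
  - by move=> y /andP[yr _]; case: (jost_int J yr).
  move=> h1 _; apply: (le_trans h1); apply: ler_wpM2l; last exact: Xle.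
  by rewrite mulr_ge0.
have oneG : `|1 : R| <= G by rewrite normr1; lra.
have UG x : `|U x| <= G.
  apply: (le_trans (bU x)); apply: (@le_trans _ _ (1 * (MU + MV + 1))).
    lra.
  by rewrite /G; apply: ler_wpM2r => //; lra.
have bh := @volterra_bound R (- rho) rho G U (fun=> 1) h h' hm G0 lU (lbm_cst _) lh lh'
  (fun x _ => UG x) (fun _ _ => oneG)
  (fun x xr => hint x (andP xr).1) (fun x xr => hint' x (andP xr).1).
have bh1 x : - rho <= x <= rho -> `|h x| <= B /\ `|h' x| <= B.
  move=> xr; have [k1 k2] := bh x xr.
  have k3 : 2 * `|hm| * expR (2 * G * (x - - rho)) <= B.
    apply: (@le_trans _ _ (2 * `|hm| * X)); last by rewrite lerDr.
    by apply: ler_wpM2l; [rewrite mulr_ge0|exact: Xle].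
  by split; apply: le_trans k3.
have delta0 : 0 <= D0 * (l * al + w) by rewrite mulr_ge0//; lra.
have pert x : - rho <= x <= rho -> `|v x - h x| <= D1 * (l * al + w) /\
    `|p x - h' x| <= D1 * (l * al + w).
  move=> xr.
  have [] := @volterra_perturbation R (- rho) rho G (D0 * (l * al + w)) _ _ v p U (fun=> 1)
    h h' hm G0 delta0 lf (lbm_expZ (- (2 * w))) lv lp lU (lbm_cst _) lh lh' _ _ _ _
    (fun x xr => hint x (andP xr).1) (fun x xr => hint' x (andP xr).1) x xr.
  - move=> y /ab hy; split; first exact: fb.
    split; first exact: UG.
    have [e1 e2] := exp_window hy wn; have [d1 d2] := m1 y hy.
    have -> : expR (2 * w * y) * (U y + l * al * V (al * y)) - U y =
      (expR (2 * w * y) - 1) * U y + expR (2 * w * y) * (l * al * V (al * y)) by ring.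
    rewrite (le_trans (ler_normD _ _))// normrM [X in _ + X]normrM (ger0_norm (expR_ge0 _)).
    have k1 : `|expR (2 * w * y) - 1| * `|U y| <= E * (2 * rho) * w * MU by exact: ler_pM.
    have k2 : expR (2 * w * y) * `|l * al * V (al * y)| <= E * (l * al * MV).
      apply: ler_pM => //; rewrite normrM (gtr0_norm la0); apply: ler_wpM2l => //.
      exact: ltW.
    have k3 : 0 <= E * (2 * rho) by nonneg.
    have k4 : 0 <= E * (2 * rho) * w by rewrite mulr_ge0//; lra.
    have k5 : 0 <= E * (2 * rho) * (MU + 1) * (l * al).
      by nonneg.
    have k6 : 0 <= E * MV * w by nonneg.
    by rewrite /D0; lra.
  - move=> y /ab hy; split; first exact: gb.
    split => //; have [d1 d2] := m1 y hy; apply: (le_trans d2).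
    have k3 : 0 <= E * (2 * rho) * MU * w by nonneg.
    have k5 : 0 <= E * (2 * rho) * (MU + 1) * (l * al).
      by nonneg.
    have k6 : 0 <= E * MV * (w + l * al) by nonneg.
    by rewrite /D0; lra.
  - by move=> y /andP[yr _]; case: (jost_int J yr).
  - by move=> y /andP[yr _]; case: (jost_int J yr).
  move=> k1 k2.
  have k3 : 2 * (D0 * (l * al + w) * (2 * `|hm|) / (2 * G)) * expR (2 * G * (x - - rho))
      <= D1 * (l * al + w).
    rewrite (_ : D1 * (l * al + w) =
      2 * (D0 * (l * al + w) * (2 * `|hm|) / (2 * G)) * X); last by rewrite /D1; ring.
    apply: ler_wpM2l; last exact: Xle.
    by nonneg.
  by split; apply: le_trans k3.
move=> x xr; have [k1 k2] := bh1 x xr; have [k3 k4] := pert x xr.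
have [e1 e2] := exp_window (ab x xr) wn; have [d1 d2] := m1 x (ab x xr).
have k5 : `|v x| <= B by apply: (le_trans (bv x xr)); rewrite lerDr.
have k6 : 0 <= E * (2 * rho) * B by nonneg.
have k7 : 0 <= E * (2 * rho) * B * (l * al) by rewrite mulr_ge0// ltW.
split; first by split => //; rewrite (le_trans e1)// lerDl !mulr_ge0.
split.
  have -> : expR (2 * w * x) * v x - h x = (expR (2 * w * x) - 1) * v x + (v x - h x) by ring.
  rewrite (le_trans (ler_normD _ _))// normrM.
  have k8 : `|expR (2 * w * x) - 1| * `|v x| <= E * (2 * rho) * w * B by exact: ler_pM.
  lra.
apply: (le_trans k4); apply: ler_wpM2r; first lra.
by rewrite lerDr.
Qed.

Lemma AC_expv l al w v p : jost (W l al) rho hm w v p ->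
  AC_with_deriv (fun x => expR (2 * w * x) * v x)
                (fun x => 2 * w * (expR (2 * w * x) * v x) + p x).
Proof.
move=> [h1 _ lv lp _].
apply: AC_ext (ACM _ _ (AC_expZ (2 * w)) h1).
- move=> x; rewrite [X in _ + X]mulrA -expRD mulNr addrN expR0; ring.
- by apply: lbmZ; exact: lbm_expZ.
- by apply: lbmM => //; exact: lbm_expZ.
Qed.

(** Put [m = expR (2 * w * x) * v], so that [m' = 2 * w * m + p]. In the derivative of
    [h * p - h' * m] the terms [h' * p] and [U * h * m] cancel, leaving [l * al * V (al * x) * m * h
    - 2 * w * m * h']. At [- rho] both [p] and [h'] vanish, and [h'] vanishes at [rho]. *)
Lemma jost_wronskian l al w v p : jost (W l al) rho hm w v p ->
  hp * p rho =
  l * al * \int[mu]_(x in `[- rho, rho]) (V (al * x) * (expR (2 * w * x) * v x * h x)) -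
  2 * w * \int[mu]_(x in `[- rho, rho]) (expR (2 * w * x) * v x * h' x).
Proof.
have r0 := rho0.
move=> J; have [h1 h2 lv lp h3] := J; have ACm := AC_expv J.
have lm : lbm (fun x => expR (2 * w * x) * v x) by apply: lbmM => //; exact: lbm_expZ.
have lm' : lbm (fun x => 2 * w * (expR (2 * w * x) * v x) + p x).
  by apply: lbmD => //; exact: lbmZ.
have lW := lbm_potential l al.
have lp' : lbm (fun x => expR (2 * w * x) * (U x + l * al * V (al * x)) * v x).
  by apply: lbmM => //; apply: lbmM => //; exact: lbm_expZ.
have lUh : lbm (fun x => U x * h x) by exact: lbmM.
have rr : - rho <= rho by lra.
have e1 := ((ACM lh' lp' ACh h2) _ _ rr).2.
have e2 := ((ACM lUh lm' ACh' ACm) _ _ rr).2.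
have [_ pl] := h3 (- rho) (lexx _).
rewrite pl mulr0 subr0 hr in e1; rewrite hl' hr' !mul0r subr0 in e2.
have l1 : lbm (fun x => V (al * x) * (expR (2 * w * x) * v x * h x)).
  by apply: lbmM; [exact: lbm_scaled|exact: lbmM].
have l2 : lbm (fun x => expR (2 * w * x) * v x * h' x) by exact: lbmM.
rewrite -!intZ// -intB; [|exact: lbmZ|exact: lbmZ].
rewrite e1 -[LHS]subr0 [X in _ - X]e2 -intB; [|by apply: lbmD; exact: lbmM|by apply: lbmD; exact: lbmM].
by apply: eq_int => x _; ring.
Qed.

Lemma scaled_moments al : 1 <= al ->
  \int[mu]_(x in `[- rho, rho]) V (al * x) = 0 /\
  \int[mu]_(x in `[- rho, rho]) (V (al * x) * x) = IxV / al ^+ 2.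
Proof.
have r0 := rho0; have rr0 := rVrho.
move=> al1; have al0 : 0 < al by lra.
have s0 x : rho < `|x| -> V (al * x) = 0.
  move=> xr; apply: V0; rewrite normrM gtr0_norm//.
  have : `|x| <= al * `|x| by rewrite ler_peMl.
  lra.
have lxV : lbm (fun x => x * V x) by apply: lbmM => //; exact: lbm_id.
have xV0 x : rV < `|x| -> x * V x = 0 by move=> /V0 ->; rewrite mulr0.
split.
  rewrite -(int_compact (lbm_scaled al) s0).2.
  have := int_scale al0 lV V0; rewrite intV => /esym/eqP.
  by rewrite mulf_eq0 gt_eqF//= => /eqP.
have l1 : lbm (fun x => V (al * x) * x) by apply: lbmM; [exact: lbm_scaled|exact: lbm_id].
have l10 x : rho < `|x| -> V (al * x) * x = 0 by move=> /s0 ->; rewrite mul0r.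
have [i1 <-] := int_compact l1 l10.
rewrite (int_scale al0 lxV xV0).
rewrite (_ : (fun x => al * x * V (al * x)) = (fun x => al * (V (al * x) * x))); last first.
  by apply/funext => x; ring.
rewrite RintegralZl//; field; exact: lt0r_neq0.
Qed.

(** On the support of [V (al * x)], of half-width at most [q = rV / al], the factor [phi] is
    compared with [phi 0 + c * x], where [c] is the derivative of [h ^+ 2] at 0. The zero mean
    removes [phi 0] and the first moment gives the main term. The remainder has a derivative of
    order [eta], hence is at most [D4 * eta * q]; integrated over a length [2 * q] and multiplied by
    [l * al], it is of order [l / al * eta]. *)
Lemma potential_term : exists C : R, 0 <= C /\
  forall l al w v p, 0 < l -> 1 <= al -> l * al <= 1 -> 0 <= w <= 1 ->
  jost (W l al) rho hm w v p ->
  `|l * al * \int[mu]_(x in `[- rho, rho]) (V (al * x) * (expR (2 * w * x) * v x * h x)) -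
    l / al * (2 * h 0 * h' 0 * IxV)| <= C * (l / al) * (l * al + w + al^-1).
Proof.
have r0 := rho0; have rr0 := rVrho; have u0 := MU0; have v0 := MV0; have rv0 := rV0.
have [D [B [D0 B0 hDB]]] := jost_close.
pose L := B * B + MU * B * B.
have L0 : 0 <= L by nonneg.
pose D4 := 2 * B * B * B + 2 * D * B + 2 * (L * rV).
have D40 : 0 <= D4 by nonneg.
exists (2 * MV * rV * rV * D4); split; first by nonneg.
move=> l al w v p l0 al1 la1 w01 J; have al0 : 0 < al by lra.
have hx := hDB l al w v p l0 al1 la1 w01 J.
have [_ _ lv lp _] := J; have ACm := AC_expv J.
have lm : lbm (fun x => expR (2 * w * x) * v x) by apply: lbmM => //; exact: lbm_expZ.
have lm' : lbm (fun x => 2 * w * (expR (2 * w * x) * v x) + p x).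
  by apply: lbmD => //; exact: lbmZ.
pose q := rV / al; pose eta := l * al + w + al^-1.
have ia0 : 0 < al^-1 by rewrite invr_gt0.
have eta0 : 0 <= eta by rewrite !addr_ge0//; [rewrite mulr_ge0// ltW|lra|exact: ltW].
have q0 : 0 <= q by rewrite divr_ge0// ltW.
have qrho : q <= rho.
  rewrite ler_pdivrMr//; have : rho <= rho * al by rewrite ler_peMr// ltW.
  lra.
have qE : q <= rV * eta.
  by rewrite ler_wpM2l//; have : 0 < l * al by [rewrite mulr_gt0]; rewrite /eta; lra.
pose phi x := expR (2 * w * x) * v x * h x.
pose psi x := (2 * w * (expR (2 * w * x) * v x) + p x) * h x + expR (2 * w * x) * v x * h' x.
have lphi : lbm phi by exact: lbmM.
have lpsi : lbm psi by apply: lbmD; exact: lbmM.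
have ACphi : AC_with_deriv phi psi by exact: ACM.
pose c := 2 * h 0 * h' 0.
pose F x := phi x + - c * x.
have ACF : AC_with_deriv F (fun x => psi x + - c * 1).
  apply: ACD => //; [exact: lbm_cst|].
  apply: (@ACZ _ (- c) idfun (fun=> 1)); first exact: lbm_cst.
  apply: AC_intro; first exact: lbm_cst.
  by move=> a b ab; rewrite int_cst// mul1r.
have lhh : lbm (fun x => h' x * h' x + h x * (U x * h x)).
  by apply: lbmD; apply: lbmM => //; exact: lbmM.
have lUh : lbm (fun x => U x * h x) by exact: lbmM.
have inq x : - q <= x <= q -> - rho <= x <= rho by lra.
have hhlip x : - q <= x <= q -> `|h x * h' x - h 0 * h' 0| <= L * q.
  move=> xq.
  have k1 : `|h x * h' x - h 0 * h' 0| <= L * `|x - 0|.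
    apply: (AC_lip (F := fun x => h x * h' x) (a := - q) (b := q) lhh) => //; last lra.
    - exact: ACM.
    - move=> y /inq yr; have [[_ k1 k2 _] _] := hx y yr.
      rewrite (le_trans (ler_normD _ _))// !normrM /L.
      have k3 : `|h' y| * `|h' y| <= B * B by exact: ler_pM.
      have k4 : `|h y| * (`|U y| * `|h y|) <= B * (MU * B).
        by apply: ler_pM => //; exact: ler_pM.
      lra.
  apply: (le_trans k1); apply: ler_wpM2l => //.
  by rewrite subr0 ler_norml.
have psib x : - q <= x <= q -> `|psi x + - c * 1| <= D4 * eta.
  move=> xq; have [[k1 k2 k3 k4] [k5 k6]] := hx x (inq x xq).
  have k7 := hhlip x xq.
  (* The four errors come from the weight, from [p] against [h'], from the solution against [h], and
     from the variation of [h * h'] over the shrinking support; the last one accounts for [al^-1] in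
     [eta]. *)
  have -> : psi x + - c * 1 = 2 * w * (expR (2 * w * x) * v x * h x) + (p x - h' x) * h x +
    (expR (2 * w * x) * v x - h x) * h' x + 2 * (h x * h' x - h 0 * h' 0).
    by rewrite /psi /c; ring.
  have j1 : `|2 * w * (expR (2 * w * x) * v x * h x)| <= 2 * w * (B * B * B).
    rewrite normrM ger0_norm; last by rewrite mulr_ge0//; lra.
    apply: ler_wpM2l; first by rewrite mulr_ge0//; lra.
    rewrite !normrM (ger0_norm (expR_ge0 _)).
    by apply: ler_pM => //; rewrite ?mulr_ge0 ?expR_ge0 ?ler_pM ?expR_ge0.
  have j2 : `|(p x - h' x) * h x| <= D * (l * al + w) * B by rewrite normrM ler_pM.
  have j3 : `|(expR (2 * w * x) * v x - h x) * h' x| <= D * (l * al + w) * B.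
    by rewrite normrM ler_pM.
  have j4 : `|2 * (h x * h' x - h 0 * h' 0)| <= 2 * (L * q).
    by rewrite normrM ger0_norm// ler_pM2l.
  have j5 : L * q <= L * (rV * eta) by exact: ler_wpM2l.
  have weta : w <= eta by rewrite /eta; have : 0 < l * al by [rewrite mulr_gt0]; lra.
  have j6 : 2 * w * (B * B * B) <= 2 * eta * (B * B * B).
    by apply: ler_wpM2r; [rewrite !mulr_ge0|lra].
  have j7 : D * (l * al + w) * B <= D * eta * B.
    by apply: ler_wpM2r => //; apply: ler_wpM2l => //; rewrite /eta lerDl ltW.
  apply: (le_trans (ler_normD _ _)); apply: (le_trans (lerD (ler_normD _ _) (lexx _))).
  apply: (le_trans (lerD (lerD (ler_normD _ _) (lexx _)) (lexx _))).
  by rewrite /D4; lra.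
have Fb x : - q <= x <= q -> `|F x - F 0| <= D4 * eta * q.
  move=> xq.
  have k1 : `|F x - F 0| <= D4 * eta * `|x - 0|.
    apply: (AC_lip (a := - q) (b := q) _ ACF psib) => //; last lra.
    by apply: lbmD => //; exact: lbm_cst.
  apply: (le_trans k1); apply: ler_wpM2l; first exact: mulr_ge0.
  by rewrite subr0 ler_norml.
have [mom0 mom1] := scaled_moments al1.
have lVs := lbm_scaled al.
have lF : lbm (fun x => F x - F 0).
  apply: lbmB; last exact: lbm_cst.
  by apply: lbmD => //; apply: lbmZ; exact: lbm_id.
have lVF : lbm (fun x => V (al * x) * (F x - F 0)) by exact: lbmM.
have split : \int[mu]_(x in `[- rho, rho]) (V (al * x) * phi x) =
    \int[mu]_(x in `[- rho, rho]) (V (al * x) * (F x - F 0)) + c * (IxV / al ^+ 2).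
  have l0x : lbm (fun x => V (al * x) * x) by apply: lbmM => //; exact: lbm_id.
  have -> : \int[mu]_(x in `[- rho, rho]) (V (al * x) * phi x) =
      \int[mu]_(x in `[- rho, rho]) (V (al * x) * (F x - F 0)) +
      c * \int[mu]_(x in `[- rho, rho]) (V (al * x) * x) +
      F 0 * \int[mu]_(x in `[- rho, rho]) V (al * x).
    rewrite -!intZ// -intD//; last exact: lbmZ.
    rewrite -intD; [|by apply: lbmD => //; exact: lbmZ|exact: lbmZ].
    by apply: eq_int => x _; rewrite /F; ring.
  by rewrite mom0 mom1 mulr0 addr0.
rewrite split.
have -> : l * al * (\int[mu]_(x in `[- rho, rho]) (V (al * x) * (F x - F 0)) +
    c * (IxV / al ^+ 2)) - l / al * (2 * h 0 * h' 0 * IxV) =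
    l * al * \int[mu]_(x in `[- rho, rho]) (V (al * x) * (F x - F 0)).
  by rewrite /c; field; exact: lt0r_neq0.
have Vs0 b x : q <= b -> b < `|x| -> V (al * x) * (F x - F 0) = 0.
  move=> qb bx; rewrite V0 ?mul0r// normrM gtr0_norm// mulrC -ltr_pdivrMr//.
  exact: le_lt_trans qb bx.
(* The integral passes from the window, through the whole line, to [[- q, q]], whose length brings a
   further factor [al^-1]. *)
rewrite -(int_compact lVF (fun x => @Vs0 rho x qrho)).2.
rewrite (int_compact lVF (fun x => @Vs0 q x (lexx _))).2.
have ib : `|\int[mu]_(x in `[- q, q]) (V (al * x) * (F x - F 0))| <=
    MV * (D4 * eta * q) * (q - - q).
  apply: le_int_bound => //; first lra.
  by move=> x xq; rewrite normrM; apply: ler_pM => //; exact: Fb.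
rewrite normrM ger0_norm; last by rewrite mulr_ge0// ltW.
apply: (le_trans (ler_wpM2l _ ib)); first by rewrite mulr_ge0// ltW.
rewrite le_eqVlt; apply/orP; left; apply/eqP; rewrite /q -/eta; field; exact: lt0r_neq0.
Qed.

(** With [h] in place of the solution, the integral is that of [h * h'], namely
    [(hp ^+ 2 - hm ^+ 2) / 2], and the bracket becomes [(hp ^+ 2 + hm ^+ 2) / 2]. The error of this
    replacement is controlled by [jost_close]. *)
Lemma boundary_term : exists C : R, 0 <= C /\
  forall l al w v p, 0 < l -> 1 <= al -> l * al <= 1 -> 0 <= w <= 1 ->
  jost (W l al) rho hm w v p ->
  `|2 * w * (expR (2 * w * rho) * v rho * hp -
      \int[mu]_(x in `[- rho, rho]) (expR (2 * w * x) * v x * h' x)) -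
    w * (hp ^+ 2 + hm ^+ 2)| <= C * w * (l * al + w).
Proof.
have r0 := rho0.
have [D [B [D0 B0 hDB]]] := jost_close.
exists (2 * (D * `|hp| + D * B * (rho - - rho))); split.
  by nonneg.
move=> l al w v p l0 al1 la1 w01 J.
have hx := hDB l al w v p l0 al1 la1 w01 J.
have [_ _ lv lp _] := J.
have lm : lbm (fun x => expR (2 * w * x) * v x) by apply: lbmM => //; exact: lbm_expZ.
have rr : - rho <= rho by lra.
have e1 := ((ACM lh' lh' ACh ACh) _ _ rr).2.
rewrite hl hr in e1.
have l1 : lbm (fun x => h x * h' x) by exact: lbmM.
have e2 : \int[mu]_(x in `[- rho, rho]) (h x * h' x) = (hp ^+ 2 - hm ^+ 2) / 2.
  have -> : hp ^+ 2 - hm ^+ 2 = 2 * \int[mu]_(x in `[- rho, rho]) (h x * h' x).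
    by rewrite !expr2 e1 -intZ//; apply: eq_int => x _; ring.
  by field.
have l2 : lbm (fun x => expR (2 * w * x) * v x * h' x) by exact: lbmM.
have -> : 2 * w * (expR (2 * w * rho) * v rho * hp -
      \int[mu]_(x in `[- rho, rho]) (expR (2 * w * x) * v x * h' x)) -
    w * (hp ^+ 2 + hm ^+ 2) =
  2 * w * ((expR (2 * w * rho) * v rho - h rho) * hp -
   \int[mu]_(x in `[- rho, rho]) ((expR (2 * w * x) * v x - h x) * h' x)).
  rewrite (@eq_int _ _ _ (fun x => (expR (2 * w * x) * v x - h x) * h' x)
    (fun x => expR (2 * w * x) * v x * h' x - h x * h' x)); last by move=> x _; ring.
  by rewrite intB// e2 hr; field.
have w0 : 0 <= w by lra.
rewrite normrM ger0_norm ?mulr_ge0//.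
have k1 : `|(expR (2 * w * rho) * v rho - h rho) * hp| <= D * (l * al + w) * `|hp|.
  rewrite normrM; apply: ler_wpM2r => //.
  by have [|_ []] := hx rho; first lra.
have k2 : `|\int[mu]_(x in `[- rho, rho]) ((expR (2 * w * x) * v x - h x) * h' x)| <=
    D * (l * al + w) * B * (rho - - rho).
  apply: le_int_bound => //; first by apply: lbmM => //; exact: lbmB.
  move=> x xr; have [[_ _ j1 _] [j2 _]] := hx x xr.
  by rewrite normrM; exact: ler_pM.
apply: (@le_trans _ _ (2 * w * (D * (l * al + w) * `|hp| + D * (l * al + w) * B * (rho - - rho)))).
  apply: ler_wpM2l; first by rewrite mulr_ge0.
  by rewrite (le_trans (ler_normB _ _))// lerD.
by rewrite le_eqVlt; apply/orP; left; apply/eqP; ring.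
Qed.

(** The error has the size [w + l / al] of the main terms, times a factor that is small in the
    threshold regime. *)
Lemma jost_function_asymptotics : exists C : R, 0 <= C /\
  forall l al w v p, 0 < l -> 1 <= al -> l * al <= 1 -> 0 <= w <= 1 ->
  jost (W l al) rho hm w v p ->
  `|hp * (p rho + 2 * w * expR (2 * w * rho) * v rho) -
    (w * (hp ^+ 2 + hm ^+ 2) + l / al * (2 * h 0 * h' 0 * IxV))|
  <= C * (w + l / al) * (l * al + w + al^-1).
Proof.
have [C1 [C10 h1]] := potential_term; have [C2 [C20 h2]] := boundary_term.
exists (C1 + C2); split; first exact: addr_ge0.
move=> l al w v p l0 al1 la1 w01 J; have al0 : 0 < al by lra.
have k1 := h1 l al w v p l0 al1 la1 w01 J; have k2 := h2 l al w v p l0 al1 la1 w01 J.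
rewrite mulrDr (jost_wronskian J).
set I1 := \int[mu]_(x in _) _ in k1 *; set I2 := \int[mu]_(x in _) _ in k2 *.
have -> : l * al * I1 - 2 * w * I2 + hp * (2 * w * expR (2 * w * rho) * v rho) -
    (w * (hp ^+ 2 + hm ^+ 2) + l / al * (2 * h 0 * h' 0 * IxV)) =
    (l * al * I1 - l / al * (2 * h 0 * h' 0 * IxV)) +
    (2 * w * (expR (2 * w * rho) * v rho * hp - I2) - w * (hp ^+ 2 + hm ^+ 2)) by ring.
apply: (le_trans (ler_normD _ _)); apply: (le_trans (lerD k1 k2)).
have la0 : 0 < l * al by rewrite mulr_gt0.
have lda0 : 0 < l / al by rewrite divr_gt0.
have ia0 : 0 < al^-1 by rewrite invr_gt0.
have w0 : 0 <= w by lra.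
have j1 : 0 <= C1 * w * (l * al + w + al^-1) by nonneg.
have j2 : 0 <= C2 * (l / al) * (l * al + w + al^-1) by nonneg.
have j3 : 0 <= C2 * w * al^-1 by nonneg.
lra.
Qed.

End threshold_asymptotics.

(** * The root of the Jost function *)

Section threshold_root.
Set Implicit Arguments. Unset Strict Implicit. Unset Printing Implicit Defensive.
Context {R : realType}.
Local Notation mu := (@lebesgue_measure R).

(** With [q = l / al] and [N = hp ^+ 2 + hm ^+ 2], [hp] times the Jost function is [N * (w - c * q)]
    up to [N * (S * eta * q)]. If [S * eta < c / 2], it changes sign between [c * q / 2] and
    [2 * c * q], and the same estimate at the root locates it. Smallness is required of the numbers
    [l] and [al], independently of any relation between them. *)
Lemma threshold_eigenvalue (U V h : R -> R) (hm hp : R) :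
  Linfty_compact U -> Linfty_compact V -> half_bound_state U h ->
  h x @[x --> -oo] --> hm -> h x @[x --> +oo] --> hp -> hm != 0 ->
  Rintegral mu setT V = 0 ->
  h 0 * derive1 h 0 * Rintegral mu setT (fun x => x * V x) < 0 ->
  let c := - (2 * h 0 * derive1 h 0 * Rintegral mu setT (fun x => x * V x)) /
           (hp ^+ 2 + hm ^+ 2) in
  exists S : R, [/\ 0 <= S, 0 < c &
  forall l al : R, 0 < l -> 1 <= al -> l * al <= 1 -> 2 * c * (l / al) <= 2^-1 ->
    S * (l * al + 2 * c * (l / al) + al^-1) < c / 2 ->
    exists w : R, [/\ 0 < w,
      is_eigenvalue (fun x => U x + l * al * V (al * x)) (- w ^+ 2) &
      `|w * al / l - c| <= S * (l * al + 2 * c * (l / al) + al^-1)]].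
Proof.
move=> LU LV hU hhm hhp hm0 intV sgn; set I := Rintegral mu _ _ in sgn *.
have [lU lV] := (lbm_Linfty LU, lbm_Linfty LV).
have [_ [[MU bU] [rU U0']]] := LU; have [_ [[MV bV] [rV' V0']]] := LV.
pose rV := `|rV'|; pose rho := `|rU| + `|rV'| + 1.
have rV0 : 0 <= rV by exact: normr_ge0.
have nU := normr_ge0 rU; have nU' := ler_norm rU; have nV' := ler_norm rV'.
have rVrho : rV < rho by rewrite /rho /rV; lra.
have rho0 : 0 <= rho by lra.
have V0 x : rV < `|x| -> V x = 0 by move=> h1; apply: V0'; rewrite /rV in h1; lra.
have U0 x : rho <= `|x| -> U x = 0.
  by move=> h1; apply: U0'; rewrite /rho /rV in h1 rV0; lra.
have [ACh ACh' lh lh'] := half_bound_state_AC LU hU.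
have hL := @half_bound_state_left R U h (- rho) hm LU hU.
have [x xr||hl hl'] := hL _ hhm (- rho); [|exact: lexx|].
  by apply: U0; rewrite ler_normr; apply/orP; right; lra.
have hR := @half_bound_state_right R U h rho hp LU hU.
have [x xr||hr hr'] := hR _ hhp rho; [|exact: lexx|].
  by apply: U0; rewrite ler_normr xr.
have [C [C0 hC]] := jost_function_asymptotics lU lV bU bV V0 rV0 rVrho
  ACh ACh' lh lh' hl hl' hr hr' intV.
rewrite -/I in hC; set N := hp ^+ 2 + hm ^+ 2 in hC *.
have N0 : 0 < N.
  by rewrite ltr_wpDl ?sqr_ge0// lt0r sqrf_eq0 hm0 sqr_ge0.
move=> c.
have cN : 2 * h 0 * derive1 h 0 * I = - (c * N).
  by rewrite /c divfK ?gt_eqF// opprK.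
have c0 : 0 < c by rewrite divr_gt0//; lra.
(* On the interval searched for the root, [w + q <= (2 * c + 1) * q]; the division by [N] turns the
   error on the function into one on [w]. *)
exists (C * (2 * c + 1) / N); split => //.
  by rewrite divr_ge0 ?mulr_ge0// ?ltW//; lra.
move=> l al l0 al1 la1 small Seta.
set eta := l * al + _ + _ in Seta *; set S := C * _ / _ in Seta *.
have al0 : 0 < al by lra.
have q0 : 0 < l / al by rewrite divr_gt0.
set q := l / al in small eta Seta q0 *.
have la0 : 0 < l * al by rewrite mulr_gt0.
have ia0 : 0 < al^-1 by rewrite invr_gt0.
have cq0 : 0 < c * q by rewrite mulr_gt0.
pose W x := U x + l * al * V (al * x).
have lW : lbm W by exact: (lbm_potential lU lV bV).
have W0 x : rho <= `|x| -> W x = 0.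
  by move=> xr; exact: (potential_support U0 V0 rVrho).
have /choice[v /choice[p J]] : forall w, exists v p, jost W rho hm w v p.
  by move=> w; exact: jost_exists.
pose F w := hp * (p w rho + 2 * w * expR (2 * w * rho) * v w rho).
have Fest (w : R) : c * q / 2 <= w <= 2 * c * q -> `|F w - N * (w - c * q)| <= N * (S * eta * q).
  move=> hw; have w01 : 0 <= w <= 1 by lra.
  have := hC l al w (v w) (p w) l0 al1 la1 w01 (J w); rewrite -/q cN.
  have -> : w * N + q * - (c * N) = N * (w - c * q) by ring.
  move=> /le_trans; apply.
  have -> : N * (S * eta * q) = C * ((2 * c + 1) * q) * eta.
    by rewrite /S; field; exact: lt0r_neq0.
  apply: ler_pM; [|lra| |rewrite /eta; lra].
    by rewrite mulr_ge0//; lra.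
  by apply: ler_wpM2l => //; lra.
have SNq : N * (S * eta * q) < N * (c * q / 2).
  by rewrite ltr_pM2l// (_ : c * q / 2 = c / 2 * q) ?ltr_pM2r//; ring.
have F1 : F (c * q / 2) < 0.
  have := Fest (c * q / 2); rewrite lexx/= => /(_ ltac:(lra)).
  by rewrite ler_norml; lra.
have F2 : 0 < F (2 * c * q).
  have := Fest (2 * c * q); rewrite lexx andbT => /(_ ltac:(lra)).
  have : 0 < N * (c * q) by rewrite mulr_gt0.
  by rewrite ler_norml; lra.
have le12 : c * q / 2 <= 2 * c * q by lra.
have [||w wI Fw] := @IVT R F (c * q / 2) (2 * c * q) 0 le12.
(* The bound [2 * c * q <= 2^-1] keeps the interval inside [|w| < 1], where continuity is known. *)
- apply: continuous_in_subspaceT => w; rewrite inE/= in_itv/= => hw.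
  apply: cvgM; first exact: cvg_cst.
  apply: (jost_function_continuous rho0 lW J); rewrite ger0_norm; lra.
- by rewrite ge_min (ltW F1) le_max (ltW F2) orbT.
rewrite in_itv/= in wI.
(* The strict sign of [F] at an end point excludes [hp = 0], so that a root of [F] is a root of the
   Jost function itself. *)
have hp0 : hp != 0.
  by apply/eqP => hp0; move: F1; rewrite /F hp0 mul0r ltxx.
have w0 : 0 < w by lra.
exists w; split => //.
  apply: (jost_eigenvalue w0 rho0 hm0 lW W0 (J w)).
  by apply: (mulfI hp0); rewrite mulr0.
have := Fest w wI; rewrite Fw sub0r normrN normrM gtr0_norm// ler_pM2l//.
have -> : w - c * q = (w * al / l - c) * q.
  by rewrite /q; field; rewrite !gt_eqF.
by rewrite normrM (gtr0_norm q0) ler_pM2r.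
Qed.

End threshold_root.

(** * Limits implied by the growth conditions on [alpha] *)

Section scaling_regime.
Set Implicit Arguments. Unset Strict Implicit. Unset Printing Implicit Defensive.
Context {R : realType}.
Implicit Types alpha : R -> R.

Lemma at_right0_cvg0 : (fun l : R => l) @ 0^'+ --> (0 : R).
Proof. by apply: cvg_at_right_filter; exact: cvg_id. Qed.

Lemma cvg_pinfty_inv alpha : alpha l @[l --> 0^'+] --> +oo ->
  (alpha l)^-1 @[l --> 0^'+] --> 0.
Proof.
move=> ha; apply/cvgrPdist_le => e e0.
have ie0 : 0 < e^-1 by rewrite invr_gt0.
move/cvgryPge : ha => /(_ e^-1); apply: filterS => l hl.
rewrite sub0r normrN normfV gtr0_norm; last exact: lt_le_trans hl.
by rewrite -[e]invrK lef_pV2// posrE//; exact: lt_le_trans hl.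
Qed.

(** With [s] the cube root of [l], the product [l * alpha l] is [s ^+ 2 * (alpha l * s)], and
    [s <= 1] once [l <= 1]. *)
Lemma cube_root_regime alpha : (forall l, 0 < l -> 0 < alpha l) ->
  alpha l * l `^ (3^-1) @[l --> 0^'+] --> 0 ->
  l * alpha l @[l --> 0^'+] --> 0.
Proof.
move=> a0 h; apply/cvgrPdist_le => e e0.
move/cvgrPdist_le : h => /(_ e e0) he; near=> l.
have l0 : 0 < l by near: l; exact: nbhs_right_gt.
have l1 : l <= 1 by near: l; apply: nbhs_right_le; exact: ltr01.
have : `|0 - alpha l * l `^ (3^-1)| <= e by near: l; exact: he.
rewrite !sub0r !normrN.
set s := l `^ _.
have s0 : 0 < s by exact: powR_gt0.
have s3 : s ^+ 3 = l.
  by rewrite -powR_mulrn ?ltW// -powRrM mulVf// powRr1// ltW.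
have s1 : s <= 1 by rewrite -(@expr_le1 _ 3)// ?s3// ltW.
apply: le_trans.
have al0 := a0 l l0.
rewrite !gtr0_norm ?mulr_gt0//.
rewrite -[X in X * _]s3 mulrC ler_pM2l// exprS -[X in _ <= X]mulr1 ler_pM2l//.
by rewrite expr_le1// ltW.
Unshelve. all: by end_near. Qed.

Lemma cvg0_div_pinfty alpha : alpha l @[l --> 0^'+] --> +oo ->
  l / alpha l @[l --> 0^'+] --> 0.
Proof.
by move=> /cvg_pinfty_inv ha; have k := cvgM at_right0_cvg0 ha; rewrite mulr0 in k; exact: k.
Qed.

Lemma at_right0_ex (P : R -> Prop) : (\forall l \near 0^'+, P l) ->
  exists2 d : R, 0 < d & forall l, 0 < l < d -> P l.
Proof.
rewrite near_withinE => /nbhs_ballP[d /= d0 hd]; exists d => // l /andP[l0 ld].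
by apply: hd => //; rewrite /ball/= sub0r normrN gtr0_norm.
Qed.

End scaling_regime.

(** * Threshold and asymptotics of the eigenvalue *)

Theorem theorem3 (R : realType) (U V : R -> R) (alpha : R -> R)
  (h : R -> R) (hm hp : R) :
  Linfty_compact U -> Linfty_compact V ->
  (forall l, 0 < l -> 0 < alpha l) ->
  alpha l @[l --> 0^'+] --> +oo ->
  half_bound_state U h ->
  h x @[x --> -oo] --> hm -> h x @[x --> +oo] --> hp -> hm != 0 ->
  let u := fun x => h x / hm in
  let u' := fun x => (derive1 h) x / hm in
  let theta := hp / hm in
  let IxV := Rintegral (@lebesgue_measure R) setT (fun x => x * V x) in
  Rintegral (@lebesgue_measure R) setT V = 0 ->
  u 0 * u' 0 * IxV < 0 ->
  alpha l * l `^ (3^-1) @[l --> 0^'+] --> 0 ->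
  let H := fun l x => U x + l * alpha l * V (alpha l * x) in
  exists (e : R -> R) (l0 : R), 0 < l0 /\
    (forall l, 0 < l < l0 -> e l < 0 /\ is_eigenvalue (H l) (e l)) /\
    e l @[l --> 0^'+] --> 0 /\
    e l * (alpha l) ^+ 2 / l ^+ 2 @[l --> 0^'+] -->
      - ((2 * u 0 * u' 0 / (theta ^+ 2 + 1) * IxV) ^+ 2).
Proof.
move=> LU LV a0 ainf hU hhm hhp hm0 u u' theta IxV intV sgn ao H.
have hm2 : 0 < hm ^+ 2 by rewrite lt0r sqrf_eq0 hm0 sqr_ge0.
have sgn' : h 0 * derive1 h 0 * IxV < 0.
  have -> : h 0 * derive1 h 0 * IxV = u 0 * u' 0 * IxV * hm ^+ 2.
    by rewrite /u /u'; field.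
  by rewrite nmulr_rlt0.
have := threshold_eigenvalue LU LV hU hhm hhp hm0 intV sgn'.
rewrite -/IxV; set c := - _ / _ => /= -[S [S0 c0 hS]].
have la0 := cube_root_regime a0 ao.
have lda0 := cvg0_div_pinfty ainf.
have ia0 := cvg_pinfty_inv ainf.
have lcda0 : 2 * c * (l / alpha l) @[l --> 0^'+] --> 0.
  by have k := cvgM (cvg_cst (2 * c)) lda0; rewrite mulr0 in k; exact: k.
pose eta l := l * alpha l + 2 * c * (l / alpha l) + (alpha l)^-1.
have eta0 : S * eta l @[l --> 0^'+] --> 0.
  have k := cvgM (cvg_cst S) (cvgD (cvgD la0 lcda0) ia0).
  by rewrite !addr0 mulr0 in k; exact: k.
have [l0 l00 hl0] : exists2 l0 : R, 0 < l0 & forall l : R, 0 < l < l0 -> exists w : R, [/\ 0 < w,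
    is_eigenvalue (H l) (- w ^+ 2) & `|w * alpha l / l - c| <= S * eta l].
  apply: at_right0_ex; near=> l; apply: hS.
  - by near: l; exact: nbhs_right_gt.
  - by near: l; move/cvgryPge : ainf; exact.
  - near: l; move/cvgrPdist_le : la0 => /(_ 1 ltr01).
    apply: filterS => l; rewrite sub0r normrN; exact: le_trans (ler_norm _).
  - near: l; move/cvgrPdist_le : lcda0 => /(_ 2^-1); rewrite invr_gt0 ltr0n => /(_ isT).
    apply: filterS => l; rewrite sub0r normrN; exact: le_trans (ler_norm _).
  - near: l; move/cvgrPdist_lt : eta0 => /(_ (c / 2)); rewrite divr_gt0// => /(_ isT).
    apply: filterS => l; rewrite sub0r normrN; exact: le_lt_trans (ler_norm _).
(* The value 0 taken outside the range of small [l] is a dummy: nothing is claimed there. *)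
have /choice[w hw] : forall l : R, exists w : R, 0 < l < l0 -> [/\ 0 < w,
    is_eigenvalue (H l) (- w ^+ 2) & `|w * alpha l / l - c| <= S * eta l].
  move=> l; have [ll|_] := boolP (0 < l < l0); last by exists 0.
  by have [w hw] := hl0 l ll; exists w.
have tc : w l * alpha l / l @[l --> 0^'+] --> c.
  apply/cvgrPdist_le => e e0; near=> l.
  have ll : 0 < l < l0.
    by apply/andP; split; near: l; [exact: nbhs_right_gt|exact: nbhs_right_lt].
  have [_ _ hl] := hw l ll; rewrite distrC (le_trans hl)//.
  near: l; move/cvgrPdist_le : eta0 => /(_ e e0).
  by apply: filterS => l; rewrite sub0r normrN; exact: le_trans (ler_norm _).
(* Writing [w l] as a convergent factor times [l / alpha l] shows that it tends to zero. *)
have wE : \forall l \near 0^'+, w l * alpha l / l * (l / alpha l) = w l.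
  near=> l.
  have l1 : 0 < l by near: l; exact: nbhs_right_gt.
  by have al1 := a0 l l1; field; rewrite !gt_eqF.
exists (fun l => - w l ^+ 2), l0; split => //; split.
  by move=> l /hw[wl ev _]; split => //; rewrite oppr_lt0 exprn_gt0.
split.
  have w0 : w l @[l --> 0^'+] --> 0.
    have k := cvgM tc lda0; rewrite mulr0 in k.
    apply: (@cvg_trans _ ((fun l => w l * alpha l / l * (l / alpha l)) @ 0^'+)).
      exact: near_eq_cvg.
    exact: k.
  by have k := cvgN (cvgM w0 w0); rewrite mulr0 oppr0 in k; exact: k.
(* Dividing numerator and denominator of [c] by [hm ^+ 2] passes from [h] to [u], and the sign of
   [c] disappears in the square. *)
have -> : (2 * u 0 * u' 0 / (theta ^+ 2 + 1) * IxV) ^+ 2 = c ^+ 2.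
  have h2 : hp ^+ 2 + hm ^+ 2 != 0 by rewrite gt_eqF// ltr_wpDl ?sqr_ge0.
  by rewrite /u /u' /theta /c; field; rewrite hm0 h2.
have k := cvgN (cvgM tc tc).
apply: (@cvg_trans _ ((fun l => - (w l * alpha l / l * (w l * alpha l / l))) @ 0^'+)); last exact: k.
apply: near_eq_cvg; near=> l.
have l1 : 0 < l by near: l; exact: nbhs_right_gt.
by rewrite /=; field; rewrite gt_eqF.
Unshelve. all: by end_near. Qed.
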